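(* If $0<q<p<\infty$, then the space $\mathcal C\big(\mathcal F^p(\mathbb C),\mathcal F^q(\mathbb C)\big)$ is path connected.
   Context: $dA$ is Lebesgue measure on $\mathbb C$. For $0<p<\infty$, the Fock space $\mathcal F^p(\mathbb C)$ is the set of entire functions $f$ with $\|f\|_p=\left(\frac{p}{2\pi}\int_{\mathbb C}|f(z)|^pe^{-\frac{p|z|^2}{2}}\,dA(z)\right)^{1/p}<\infty$ (a Banach space if $p\ge1$; a complete metric space with distance $\|f-g\|_p^p$ if $0<p<1$). For an entire function $\varphi$, the composition operator is $C_\varphi f=f\circ\varphi$. A linear operator $T:\mathcal F^p(\mathbb C)\to\mathcal F^q(\mathbb C)$ is bounded if it maps $\mathcal F^p(\mathbb C)$ into $\mathcal F^q(\mathbb C)$ and $\|T\|=\sup_{\|f\|_p\le1}\|Tf\|_q<\infty$. $\mathcal C(\mathcal F^p(\mathbb C),\mathcal F^q(\mathbb C))$ is the set of all bounded composition operators from $\mathcal F^p(\mathbb C)$ into $\mathcal F^q(\mathbb C)$ with the operator norm topology, i.e. the topology of the metric $\|S-T\|^{\min(1,q)}$. *)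

(* Defs.v *)
From HB Require Import structures.
From mathcomp Require Import all_boot all_order all_algebra.
From mathcomp Require Import all_classical all_reals all_analysis.
From mathcomp Require Import complex.

Set Implicit Arguments.
Unset Strict Implicit.
Unset Printing Implicit Defensive.

Import Order.TTheory GRing.Theory Num.Theory.
Import numFieldNormedType.Exports.

Local Open Scope classical_set_scope.
Local Open Scope ring_scope.

Section Fock.
Context {R : realType}.
Local Notation C := R[i].

(* [C^o] is [C] as a normed space over itself, so this is complex (and not
   real) differentiability. *)
Definition entire (f : C -> C) : Prop :=
  forall z : C, derivable (f : C^o -> C^o) (z : C^o) (1 : C^o).

(* [C] is parametrized by the plane [R * R], where the product measure is the
   area measure [dA]. *)
Definition complex_of_pair (xy : R * R) : C := (xy.1 +i* xy.2)%C.

(* ((p / 2pi) * int_C |f z|^p e^{-p |z|^2 / 2} dA(z))^{1/p}, possibly +oo. *)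
Definition fock_norm (p : R) (f : C -> C) : \bar R :=
  (((p / (2 * pi))%:E *
    \int[(lebesgue_measure \x lebesgue_measure)%E]_xy
      (ComplexField.Normc.normc (f (complex_of_pair xy)) `^ p *
       expR (- (p * ComplexField.Normc.normc (complex_of_pair xy) ^+ 2 / 2)))%:E)
   `^ p^-1)%E.

Definition fock (p : R) : set (C -> C) :=
  [set f | entire f /\ (fock_norm p f < +oo)%E].

(* Operators on [fock p] take values in arbitrary functions; that they map into
   [fock q] is part of boundedness. *)
Definition op_norm (q p : R) (T : fock p -> C -> C) : \bar R :=
  ereal_sup [set fock_norm q (T f) |
    f in [set f : fock p | (fock_norm p (set_val f) <= 1)%E]].

Definition bounded_op (q p : R) (T : fock p -> C -> C) : Prop :=
  (forall f : fock p, fock q (T f)) /\ (op_norm q T < +oo)%E.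

Definition composition_op (p : R) (phi : C -> C) : fock p -> C -> C :=
  fun f => set_val f \o phi.

Definition bounded_composition_ops (p q : R) : set (fock p -> C -> C) :=
  [set T | (exists2 phi, entire phi & T = composition_op phi) /\
           bounded_op q T].

Arguments bounded_composition_ops : clear implicits.

Definition comp_space (p q : R) : Type := set_type (bounded_composition_ops p q).

Definition comp_space_dist (p q : R) (S T : comp_space p q) : \bar R :=
  (op_norm q (fun f => (set_val S f \- set_val T f)%R) `^ Num.min 1%R q)%E.

Definition comp_space_ball (p q : R) (S : comp_space p q) (e : R) :
    set (comp_space p q) :=
  [set T | (comp_space_dist S T < e%:E)%E].

Definition comp_space_open (p q : R) (U : set (comp_space p q)) : Prop :=
  forall S, U S -> exists2 e : R, 0 < e & comp_space_ball S e `<=` U.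

Lemma comp_space_openT (p q : R) : @comp_space_open p q setT.
Proof. by move=> S _; exists 1. Qed.

Lemma comp_space_openI (p q : R) : setI_closed (@comp_space_open p q).
Proof.
move=> U V oU oV S [/oU[e e0 eU] /oV[d d0 dV]].
exists (Num.min e d); first by rewrite lt_min e0.
move=> T; rewrite /comp_space_ball/= EFin_min lt_min => /andP[Te Td].
by split; [exact: eU | exact: dV].
Qed.

Lemma comp_space_open_bigU (p q : R) (I : Type)
    (U : I -> set (comp_space p q)) :
  (forall i, comp_space_open (U i)) -> comp_space_open (\bigcup_i U i).
Proof.
move=> oU S [i _ /oU[e e0 eU]]; exists e => // T /eU UiT.
by exists i.
Qed.

HB.instance Definition _ (p q : R) := gen_eqMixin (comp_space p q).
HB.instance Definition _ (p q : R) := gen_choiceMixin (comp_space p q).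
HB.instance Definition _ (p q : R) :=
  isOpenTopological.Build (comp_space p q) (@comp_space_openT p q)
    (@comp_space_openI p q) (@comp_space_open_bigU p q).

End Fock.

Arguments comp_space : clear implicits.

Definition path_connected (R : realType) (T : topologicalType) : Prop :=
  forall x y : T, exists g : R -> T,
    [/\ {within `[0, 1], continuous g}, g 0 = x & g 1 = y].
Arguments path_connected : clear implicits.

(* Main.v *)
Require Import Defs.
From mathcomp Require Import all_boot all_order all_algebra.
From mathcomp Require Import all_classical all_reals all_analysis.
From mathcomp Require Import measurable_realfun.
From mathcomp Require Import complex ring lra.

(** Write F^p for the Fock space of exponent p. The reason why the space of bounded composition
operators from F^p to F^q is path connected when q < p is that it is parametrized by a convex set:
C_phi is bounded exactly when phi z = a z + b with |a| < 1, and on the pairs (a, b) with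
|a| <= rho < 1 and |b| <= B the map from (a, b) to C_phi is Lipschitz for the operator norm. The
segment between the parameters of two operators is therefore a path between them.

Lipschitz dependence. If |f|_p <= 1, then |f w| <= B e^((|w| + 2)^2 / 2), and f is locally
Lipschitz with a constant of the same shape ([fock_pointwise], [fock_lipschitz]). After
composition with affine maps with |a| <= rho < 1, the difference of the two functions grows at
most like e^(|z| + (rho |z| + B)^2 / 2), which the Gaussian weight of F^q absorbs for every q
([gauss_dominated], [affine_comp_lipschitz]).

Necessity. The kernels e^(conj w * z - |w|^2 / 2) lie in the unit ball of F^p. Composing the one
with w = phi z with phi and evaluating at z gives |phi z| <= |z| + K
([composition_linear_growth]), so by Liouville's theorem phi z = a z + b with |a| <= 1
([affine_of_linear_growth]). If |a| = 1, then C_phi is a rotation up to a translation and cannot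
improve integrability: the Gaussians e^(al z^2 / 2), suitably rotated, have F^p norm at most
(1 - al)^(-1 / 2p), while the F^q norms of their images are at least a constant times
(1 - al)^(-1 / 2q), a larger power as al tends to 1 ([unimodular_unbounded]).

Complex analysis. An entire function is only assumed to be complex differentiable at each point.
Everything comes from Goursat's theorem on rectangles ([goursat]), applied to the difference
quotient (g z - l (z - w)) / (z - w)^2 off w; it bounds g'(w) by the integral of |g| over the
boundary of any rectangle around w of bounded eccentricity ([cauchy_bound]). With z -> (z - w) f z
this is a mean value inequality, and with f - f w it is Cauchy's estimate. As only orders of growth
matter, the constants are not sharp. Rectangles rather than circles make the passage to area
integrals elementary: by Tonelli's theorem some line in each strip has a small integral, and four
such lines bound a rectangle ([submean_area]). The local bound for exponents p < 1
([local_bound]) follows from the one for p = 1 by weighting |f| with a power of the distance to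
the boundary of the square. *)

Set Implicit Arguments.
Unset Strict Implicit.
Unset Printing Implicit Defensive.

Import Order.TTheory GRing.Theory Num.Theory.
Import numFieldNormedType.Exports.
Import ComplexField.Normc.

Local Open Scope classical_set_scope.
Local Open Scope ring_scope.

Local Notation nc := (@normc _).
Local Notation Re := (@complex.Re _).
Local Notation Im := (@complex.Im _).
Local Notation mu := (@lebesgue_measure _).

(** * Nested bisection *)

(** The common engine of Goursat's theorem, of the boundedness of entire functions on squares and
of the mean value inequality: the nested rectangles converge to a point, near which a local
estimate contradicts badness. *)
Lemma bisection (R : realType) (Bad : R -> R -> R -> R -> Prop) a b c d :
  a <= b -> c <= d ->
  (forall a b c d, a <= b -> c <= d -> Bad a b c d ->
     [\/ Bad a ((a + b) / 2) c ((c + d) / 2),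
         Bad ((a + b) / 2) b c ((c + d) / 2),
         Bad a ((a + b) / 2) ((c + d) / 2) d |
         Bad ((a + b) / 2) b ((c + d) / 2) d]) ->
  Bad a b c d ->
  exists x y, [/\ a <= x <= b, c <= y <= d &
    forall e, 0 < e -> exists a' b' c' d',
      [/\ a' <= x <= b', c' <= y <= d', b' - a' < e, d' - c' < e &
          Bad a' b' c' d']].
Proof.
move=> ab cd split4 bad.
pose lo1 (q : (R * R) * (R * R)) := q.1.1; pose hi1 (q : (R * R) * (R * R)) := q.1.2.
pose lo2 (q : (R * R) * (R * R)) := q.2.1; pose hi2 (q : (R * R) * (R * R)) := q.2.2.
pose good q := [/\ lo1 q <= hi1 q, lo2 q <= hi2 q &
  Bad (lo1 q) (hi1 q) (lo2 q) (hi2 q)].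
have : forall q, exists q', good q ->
    [/\ good q', lo1 q <= lo1 q' /\ hi1 q' <= hi1 q,
       lo2 q <= lo2 q' /\ hi2 q' <= hi2 q,
       hi1 q' - lo1 q' = (hi1 q - lo1 q) / 2 &
       hi2 q' - lo2 q' = (hi2 q - lo2 q) / 2].
  move=> [[x1 x2] [y1 y2]]; have [|nq] := pselect (good ((x1, x2), (y1, y2))); last first.
    by exists ((x1, x2), (y1, y2)).
  move=> gq; have := gq; rewrite /good /lo1 /hi1 /lo2 /hi2 /= => -[x12 y12 bq].
  have [H|H|H|H] := split4 _ _ _ _ x12 y12 bq;
    [exists ((x1, (x1 + x2) / 2), (y1, (y1 + y2) / 2))
    |exists (((x1 + x2) / 2, x2), (y1, (y1 + y2) / 2))
    |exists ((x1, (x1 + x2) / 2), ((y1 + y2) / 2, y2))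
    |exists (((x1 + x2) / 2, x2), ((y1 + y2) / 2, y2))] => _;
  rewrite /good /lo1 /hi1 /lo2 /hi2 /=; split; first [split=> //; lra|lra].
move=> /choice[next nextP].
pose u n := iter n next ((a, b), (c, d)).
have gu n : good (u n).
  by elim: n => [//|n IH]; have [] := nextP _ IH.
have mon f (f_next : forall q, good q -> f q <= f (next q)) m n :
    (m <= n)%N -> f (u m) <= f (u n) :> R.
  move=> /subnK <-; elim: (n - m)%N => [//|k IH].
  by rewrite addSn; apply: (le_trans IH); exact: f_next.
have size1 n : hi1 (u n) - lo1 (u n) = (b - a) / 2 ^+ n.
  elim: n => [|n IH]; first by rewrite expr0 divr1.
  have [_ _ _ -> _] := nextP _ (gu n).
  by rewrite -/(u n) IH exprS; field; rewrite expf_neq0.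
have size2 n : hi2 (u n) - lo2 (u n) = (d - c) / 2 ^+ n.
  elim: n => [|n IH]; first by rewrite expr0 divr1.
  have [_ _ _ _ ->] := nextP _ (gu n).
  by rewrite -/(u n) IH exprS; field; rewrite expf_neq0.
have lim lo hi : (forall q, good q -> lo q <= hi q :> R) ->
    (forall q, good q -> lo q <= lo (next q) /\ hi (next q) <= hi q) ->
    exists x, forall n, lo (u n) <= x <= hi (u n).
  move=> lohi nx; pose A := range (fun n => lo (u n)).
  have ubA n : ubound A (hi (u n)).
    move=> _ [m _ <-]; have [mn|nm] := leqP m n.
      rewrite (@le_trans _ _ (lo (u n)))//; last exact: lohi.
      by apply: mon => // q /nx[].
    rewrite (@le_trans _ _ (hi (u m)))//; first exact: lohi.
    rewrite -lerN2; apply: (mon (fun q => - hi q)); last exact: ltnW.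
    by move=> q /nx[_]; rewrite lerN2.
  have A0 : A !=set0 by exists (lo (u 0%N)), 0%N.
  exists (sup A) => n; apply/andP; split.
    by apply: ub_le_sup; [exists (hi (u 0%N)); exact: ubA | exists n].
  by apply: ge_sup => //; exact: ubA.
have [x xP] := lim lo1 hi1 (fun q (h : good q) => let: And3 h1 _ _ := h in h1)
  (fun q h => let: And5 _ h2 _ _ _ := nextP q h in h2).
have [y yP] := lim lo2 hi2 (fun q (h : good q) => let: And3 _ h1 _ := h in h1)
  (fun q h => let: And5 _ _ h2 _ _ := nextP q h in h2).
exists x, y; split; [exact: (xP 0%N)|exact: (yP 0%N)|move=> e e0].
have [n nP] : exists n, (b - a + (d - c)) / 2 ^+ n < e.
  have : ((b - a + (d - c)) * (2^-1) ^+ n @[n --> \oo] --> (0 : R))%classic.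
    rewrite -[X in _ --> X](mulr0 (b - a + (d - c))).
    apply: cvgMr; apply: cvg_expr.
    by rewrite ger0_norm ?invr_ge0// invf_lt1// ltr1n.
  move=> /cvgrPdist_lt /(_ e e0) [n _ /(_ n (leqnn n))].
  rewrite sub0r normrN exprVn => h; exists n.
  exact: le_lt_trans (ler_norm _) h.
have [? ? ?] := gu n.
exists (lo1 (u n)), (hi1 (u n)), (lo2 (u n)), (hi2 (u n)); split => //.
  rewrite size1 (le_lt_trans _ nP)// ler_pM2r ?invr_gt0 ?exprn_gt0//; lra.
rewrite size2 (le_lt_trans _ nP)// ler_pM2r ?invr_gt0 ?exprn_gt0//; lra.
Qed.

(** * Integrals over segments *)

Section line_integrals.
Context {R : realType}.
Implicit Types (f g : R -> R) (a b m : R).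

Definition lineint a b f : R := \int[lebesgue_measure]_(x in `[a, b]) f x.

Definition cont_on a b f := forall x, a <= x <= b -> {for x, continuous f}.

Lemma cont_on_sub a b a' b' f : a <= a' -> b' <= b ->
  cont_on a b f -> cont_on a' b' f.
Proof.
move=> aa bb cf x /andP[ax xb]; apply: cf.
by rewrite (le_trans aa)// (le_trans xb).
Qed.

Lemma cont_on_integrable a b f : cont_on a b f ->
  lebesgue_measure.-integrable `[a, b] (EFin \o f).
Proof.
move=> cf; apply: continuous_compact_integrable; first exact: segment_compact.
by apply: continuous_in_subspaceT => x /set_mem; rewrite /= in_itv; exact: cf.
Qed.

Lemma cont_onB a b f g : cont_on a b f -> cont_on a b g ->
  cont_on a b (fun x => f x - g x).
Proof. by move=> cf cg x xab; apply: cvgB; [exact: cf|exact: cg]. Qed.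

Lemma cont_onD a b f g : cont_on a b f -> cont_on a b g ->
  cont_on a b (fun x => f x + g x).
Proof. by move=> cf cg x xab; apply: cvgD; [exact: cf|exact: cg]. Qed.

Lemma cont_onZ a b k f : cont_on a b f -> cont_on a b (fun x => k * f x).
Proof. by move=> cf x xab; apply: cvgM; [exact: cvg_cst|exact: cf]. Qed.

Lemma lineint_split a m b f : a <= m <= b -> cont_on a b f ->
  lineint a b f = lineint a m f + lineint m b f.
Proof.
move=> /andP[am mb] cf; have intf := cont_on_integrable cf.
apply/eqP; rewrite addrC -subr_eq; apply/eqP.
rewrite /lineint Rintegral_itvB ?bnd_simp//.
apply: Rintegral_itv_obnd_cbnd.
apply: integrableS intf => //.
by apply: subset_itv; rewrite bnd_simp.
Qed.

Lemma lineintD a b f g : cont_on a b f -> cont_on a b g ->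
  lineint a b (fun x => f x + g x) = lineint a b f + lineint a b g.
Proof. by move=> cf cg; apply: RintegralD => //; exact: cont_on_integrable. Qed.

Lemma lineintZ a b k f : cont_on a b f ->
  lineint a b (fun x => k * f x) = k * lineint a b f.
Proof. by move=> cf; apply: RintegralZl => //; exact: cont_on_integrable. Qed.

Lemma eq_lineint a b f g : (forall x, a <= x <= b -> f x = g x) ->
  lineint a b f = lineint a b g.
Proof.
move=> fg; apply: eq_Rintegral => x /set_mem; rewrite /= in_itv/=; exact: fg.
Qed.

Lemma le_lineint a b f g : cont_on a b f -> cont_on a b g ->
  (forall x, a <= x <= b -> f x <= g x) -> lineint a b f <= lineint a b g.
Proof.
move=> cf cg fg; apply: le_Rintegral => //; exact: cont_on_integrable.
Qed.

Lemma lineint_cst a b r : a <= b -> lineint a b (fun=> r) = r * (b - a).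
Proof.
move=> ab; rewrite /lineint Rintegral_cst//= lebesgue_measure_itv/= lte_fin.
by have [_|ba] := ltP a b => //=; rewrite (_ : b - a = 0); [ring|lra].
Qed.

Lemma cont_on_cst a b (r : R) : cont_on a b (fun=> r).
Proof. by move=> x _; exact: cvg_cst. Qed.

Lemma lineint_near a b f m e : a <= b -> cont_on a b f ->
  (forall x, a <= x <= b -> `|f x - m| <= e) ->
  `|lineint a b f - m * (b - a)| <= e * (b - a).
Proof.
move=> ab cf fm; rewrite ler_norml.
have := le_lineint cf (@cont_on_cst a b (m + e)).
have := le_lineint (@cont_on_cst a b (m - e)) cf.
rewrite !lineint_cst => // H1 H2.
have {}H1 : (m - e) * (b - a) <= lineint a b f.
  by apply: H1 => x /fm; rewrite ler_norml; lra.
have {}H2 : lineint a b f <= (m + e) * (b - a).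
  by apply: H2 => x /fm; rewrite ler_norml; lra.
by apply/andP; split; nra.
Qed.

End line_integrals.

(** * Goursat's theorem for closed forms on rectangles *)

Section goursat.
Context {R : realType}.
Implicit Types (P Q : R -> R -> R) (a b c d x y : R).

(** The integral of the form P dx + Q dy over the boundary of [a, b] x [c, d], traversed
counterclockwise. Opposite sides are put under one integral sign, so that the linear part of P
and Q at a point contributes constants only. *)
Definition rectint P Q a b c d :=
  lineint a b (fun x => P x c - P x d) + lineint c d (fun y => Q b y - Q a y).

(** P and Q are differentiable at (x, y), and the derivative of P in y equals the derivative be of
Q in x: pointwise closedness, without continuity of the derivatives. *)
Definition closed_at P Q x y := exists al be ga : R,
  forall e : R, 0 < e -> exists2 del : R, 0 < del & forall s t,
    `|s - x| < del -> `|t - y| < del ->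
    `|P s t - P x y - (al * (s - x) + be * (t - y))| <= e * (`|s - x| + `|t - y|) /\
    `|Q s t - Q x y - (be * (s - x) + ga * (t - y))| <= e * (`|s - x| + `|t - y|).

Lemma continuous_eps (f : R -> R) x :
  (forall e : R, 0 < e -> exists2 del : R, 0 < del &
     forall s, `|s - x| < del -> `|f s - f x| <= e) ->
  {for x, continuous f}.
Proof.
move=> H; apply/cvgrPdist_le => e /H[del del0 {}H].
apply/nbhs_ballP; exists del => // s; rewrite /ball/= => sx.
by rewrite distrC; apply: H; rewrite distrC.
Qed.

Lemma closed_at_eps P Q x y : closed_at P Q x y -> forall e : R, 0 < e ->
  exists2 del : R, 0 < del & forall s t, `|s - x| < del -> `|t - y| < del ->
    `|P s t - P x y| <= e /\ `|Q s t - Q x y| <= e.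
Proof.
move=> [al [be [ga H]]] e e0; have [del del0 {}H] := H 1 ltr01.
pose K := `|al| + `|be| + `|ga| + 1.
have K0 : 0 < K by rewrite ltr_wpDl// !addr_ge0.
exists (Num.min del (e / (2 * K))) => [|s t].
  by rewrite lt_min del0 divr_gt0// mulr_gt0.
rewrite !lt_min !ltr_pdivlMr ?mulr_gt0// => /andP[sx sxK] /andP[ty tyK].
have lin (u v : R) : `|u| <= `|al| + `|be| + `|ga| -> `|v| <= `|al| + `|be| + `|ga| ->
    `|u * (s - x) + v * (t - y)| <= (K - 1) * (`|s - x| + `|t - y|).
  move=> uK vK; rewrite (le_trans (ler_normD _ _))// !normrM mulrDr /K addrK.
  by rewrite lerD// ler_wpM2r.
have b1 : K * (`|s - x| + `|t - y|) <= e by nra.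
have tri (u v : R) : `|u - v| <= 1 * (`|s - x| + `|t - y|) ->
    `|v| <= (K - 1) * (`|s - x| + `|t - y|) -> `|u| <= e.
  move=> uv vK; rewrite (le_trans _ b1)// -[u](subrK v).
  by rewrite (le_trans (ler_normD _ _))//; nra.
have [H1 H2] := H s t sx ty.
split; [apply: (tri _ _ H1)|apply: (tri _ _ H2)]; apply: lin; clear;
  have := normr_ge0 al; have := normr_ge0 be; have := normr_ge0 ga; lra.
Qed.

Lemma closed_at_cont1 P Q x y : closed_at P Q x y ->
  {for x, continuous (P ^~ y)}.
Proof.
move=> /closed_at_eps H; apply: continuous_eps => e /H[del del0 {}H].
exists del => // s sx.
by have [] := H s y sx; rewrite ?subrr ?normr0.
Qed.

Lemma closed_at_cont2 P Q x y : closed_at P Q x y ->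
  {for y, continuous (Q x)}.
Proof.
move=> /closed_at_eps H; apply: continuous_eps => e /H[del del0 {}H].
exists del => // t ty.
by have [] := H x t _ ty; rewrite ?subrr ?normr0.
Qed.

Lemma rectint_split1 P Q a m b c d : a <= m <= b ->
  cont_on a b (P ^~ c) -> cont_on a b (P ^~ d) ->
  cont_on c d (Q a) -> cont_on c d (Q m) -> cont_on c d (Q b) ->
  rectint P Q a b c d = rectint P Q a m c d + rectint P Q m b c d.
Proof.
move=> amb Pc Pd Qa Qm Qb; rewrite /rectint (lineint_split amb); last exact: cont_onB.
have -> : lineint c d (fun y => Q b y - Q a y) =
   lineint c d (fun y => Q b y - Q m y) + lineint c d (fun y => Q m y - Q a y).
  rewrite -lineintD; try exact: cont_onB.
  by apply: eq_lineint => y _; ring.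
by ring.
Qed.

Lemma rectint_split2 P Q a b c n d : c <= n <= d ->
  cont_on a b (P ^~ c) -> cont_on a b (P ^~ n) -> cont_on a b (P ^~ d) ->
  cont_on c d (Q a) -> cont_on c d (Q b) ->
  rectint P Q a b c d = rectint P Q a b c n + rectint P Q a b n d.
Proof.
move=> cnd Pc Pn Pd Qa Qb; rewrite /rectint (lineint_split cnd); last exact: cont_onB.
have -> : lineint a b (fun x => P x c - P x d) =
   lineint a b (fun x => P x c - P x n) + lineint a b (fun x => P x n - P x d).
  rewrite -lineintD; try exact: cont_onB.
  by apply: eq_lineint => y _; ring.
by ring.
Qed.

(** The first order parts of P and Q contribute be * (c - d) * (b - a) and
be * (b - a) * (d - c), which cancel; the remainder is of the order of the squared size of the
rectangle, that is, of its area when the shape is fixed. *)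
Lemma rectint_small P Q x y : closed_at P Q x y ->
  forall e : R, 0 < e -> exists2 del : R, 0 < del & forall a b c d,
    a <= x <= b -> c <= y <= d -> b - a < del -> d - c < del ->
    cont_on a b (P ^~ c) -> cont_on a b (P ^~ d) ->
    cont_on c d (Q a) -> cont_on c d (Q b) ->
    `|rectint P Q a b c d| <= e * (b - a + (d - c)) ^+ 2.
Proof.
move=> [al [be [ga H]]] e e0.
have e20 : 0 < e / 2 by rewrite divr_gt0.
have [del del0 {}H] := H (e / 2) e20.
exists del => // a b c d /andP[ax xb] /andP[cy yd] bad dcd Pc Pd Qa Qb.
have near1 s t : a <= s <= b -> c <= t <= d ->
  [/\ `|s - x| < del, `|t - y| < del & `|s - x| + `|t - y| <= b - a + (d - c)].
  move=> /andP[a_s sb] /andP[ct td].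
  have h1 : `|s - x| <= b - a by rewrite ler_norml; apply/andP; split; lra.
  have h2 : `|t - y| <= d - c by rewrite ler_norml; apply/andP; split; lra.
  by split; [exact: le_lt_trans bad|exact: le_lt_trans dcd|exact: lerD].
have cc : c <= c <= d by rewrite lexx (le_trans cy).
have dd : c <= d <= d by rewrite lexx (le_trans cy).
have aa : a <= a <= b by rewrite lexx (le_trans ax).
have bb : a <= b <= b by rewrite lexx (le_trans ax).
set w := b - a + (d - c) in near1 *.
have I1 : `|lineint a b (fun x => P x c - P x d) - be * (c - d) * (b - a)| <= e * w * (b - a).
  apply: lineint_near; [by rewrite (le_trans ax)|exact: cont_onB|].
  move=> s sab.
  have [s1 t1 w1] := near1 s c sab cc; have [_ t2 w2] := near1 s d sab dd.
  have [/ler_normlP[h1 h1'] _] := H s c s1 t1; have [/ler_normlP[h2 h2'] _] := H s d s1 t2.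
  by clear -h1 h1' h2 h2' w1 w2 e0; rewrite ler_norml; apply/andP; split; nra.
have I2 : `|lineint c d (fun y => Q b y - Q a y) - be * (b - a) * (d - c)| <= e * w * (d - c).
  apply: lineint_near; [by rewrite (le_trans cy)|exact: cont_onB|].
  move=> t tcd.
  have [s1 t1 w1] := near1 a t aa tcd; have [s2 _ w2] := near1 b t bb tcd.
  have [_ /ler_normlP[h1 h1']] := H a t s1 t1; have [_ /ler_normlP[h2 h2']] := H b t s2 t1.
  by clear -h1 h1' h2 h2' w1 w2 e0; rewrite ler_norml; apply/andP; split; nra.
have -> : rectint P Q a b c d =
  (lineint a b (fun x => P x c - P x d) - be * (c - d) * (b - a)) +
  (lineint c d (fun y => Q b y - Q a y) - be * (b - a) * (d - c)).
  by rewrite /rectint; ring.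
rewrite (le_trans (ler_normD _ _))//.
have -> : e * w ^+ 2 = e * w * (b - a) + e * w * (d - c) by rewrite /w; ring.
exact: lerD.
Qed.

Lemma rectint_quarters P Q a m b c n d : a <= m <= b -> c <= n <= d ->
  (forall y, c <= y <= d -> cont_on a b (P ^~ y)) ->
  (forall x, a <= x <= b -> cont_on c d (Q x)) ->
  rectint P Q a b c d =
    rectint P Q a m c n + rectint P Q m b c n +
    (rectint P Q a m n d + rectint P Q m b n d).
Proof.
move=> amb cnd cP cQ; have /andP[am mb] := amb; have /andP[cn nd] := cnd.
have cc : c <= c <= d by rewrite lexx (le_trans cn).
have dd : c <= d <= d by rewrite lexx (le_trans cn).
have aa : a <= a <= b by rewrite lexx (le_trans am).
have bb : a <= b <= b by rewrite lexx (le_trans am).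
have sub1 x : a <= x <= b -> cont_on c n (Q x).
  by move=> /cQ; apply: cont_on_sub.
have sub2 x : a <= x <= b -> cont_on n d (Q x).
  by move=> /cQ; apply: cont_on_sub.
rewrite (rectint_split2 cnd (cP _ cc) (cP _ cnd) (cP _ dd) (cQ _ aa) (cQ _ bb)).
congr (_ + _).
  exact: (rectint_split1 amb (cP _ cc) (cP _ cnd) (sub1 _ aa) (sub1 _ amb) (sub1 _ bb)).
exact: (rectint_split1 amb (cP _ cnd) (cP _ dd) (sub2 _ aa) (sub2 _ amb) (sub2 _ bb)).
Qed.

(** If the integral is not zero, it is at least eta times the squared size, a bound inherited by
one of the four quarters because squared sizes of quarters add up to that of the rectangle; in the
limit point this contradicts [rectint_small]. *)
Theorem goursat P Q a b c d : a <= b -> c <= d ->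
  (forall x y, a <= x <= b -> c <= y <= d -> closed_at P Q x y) ->
  rectint P Q a b c d = 0.
Proof.
move=> ab cd cl.
have contP a' b' y : a <= a' -> b' <= b -> c <= y <= d -> cont_on a' b' (P ^~ y).
  move=> aa bb cyd x /andP[ax xb]; apply: (@closed_at_cont1 P Q); apply: cl => //.
  by rewrite (le_trans aa)// (le_trans xb).
have contQ c' d' x : c <= c' -> d' <= d -> a <= x <= b -> cont_on c' d' (Q x).
  move=> cc dd axb y /andP[cy yd]; apply: (@closed_at_cont2 P Q); apply: cl => //.
  by rewrite (le_trans cc)// (le_trans yd).
apply/eqP; apply: contraT => J0.
have w0 : 0 <= b - a + (d - c) by rewrite addr_ge0// subr_ge0.
(* the added 1 keeps the denominator positive for degenerate rectangles *)
pose eta := `|rectint P Q a b c d| / (b - a + (d - c) + 1) ^+ 2.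
have eta0 : 0 < eta by rewrite divr_gt0 ?normr_gt0// exprn_gt0// ltr_wpDl.
pose Bad a' b' c' d' := [/\ a <= a' <= b, a <= b' <= b, c <= c' <= d, c <= d' <= d &
  eta * (b' - a' + (d' - c')) ^+ 2 < `|rectint P Q a' b' c' d'|].
have [||x [y [xab ycd H]]] := @bisection R Bad a b c d ab cd.
- move=> a' b' c' d' ab' cd' [aB bB cB dB big].
  set m := (a' + b') / 2; set n := (c' + d') / 2.
  have [aa' _] := andP aB; have [_ bb'] := andP bB.
  have [cc' _] := andP cB; have [_ dd'] := andP dB.
  have amb : a' <= m <= b' by rewrite /m; clear -ab'; lra.
  have cnd : c' <= n <= d' by rewrite /n; clear -cd'; lra.
  have mB : a <= m <= b.
    by have /andP[? ?] := amb; rewrite (le_trans aa')//= (le_trans _ bb').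
  have nB : c <= n <= d.
    by have /andP[? ?] := cnd; rewrite (le_trans cc')//= (le_trans _ dd').
  have E : rectint P Q a' b' c' d' =
    rectint P Q a' m c' n + rectint P Q m b' c' n +
    (rectint P Q a' m n d' + rectint P Q m b' n d').
    apply: rectint_quarters => // [y /andP[? ?]|x /andP[? ?]].
      by apply: contP => //; rewrite (le_trans cc')//= (le_trans _ dd').
    by apply: contQ => //; rewrite (le_trans aa')//= (le_trans _ bb').
  have e1 : m - a' = (b' - a') / 2 by rewrite /m; clear; field.
  have e2 : b' - m = (b' - a') / 2 by rewrite /m; clear; field.
  have e3 : n - c' = (d' - c') / 2 by rewrite /n; clear; field.
  have e4 : d' - n = (d' - c') / 2 by rewrite /n; clear; field.
  apply: contrapT => nb.
  set tot := eta * _ ^+ 2 in big.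
  have small a1 b1 c1 d1 : b1 - a1 = (b' - a') / 2 -> d1 - c1 = (d' - c') / 2 ->
     a <= a1 <= b -> a <= b1 <= b -> c <= c1 <= d -> c <= d1 <= d ->
     ~ Bad a1 b1 c1 d1 -> `|rectint P Q a1 b1 c1 d1| <= tot / 4.
    move=> h1 h2 ? ? ? ? nB'; rewrite leNgt; apply/negP => lt; apply: nB'.
    split => //; rewrite (le_lt_trans _ lt)// h1 h2 le_eqVlt; apply/orP; left; apply/eqP.
    by rewrite /tot; clear; field.
  suff : `|rectint P Q a' b' c' d'| <= tot by rewrite leNgt big.
  have s1 : `|rectint P Q a' m c' n| <= tot / 4.
    by apply: small => // B; apply: nb; constructor 1.
  have s2 : `|rectint P Q m b' c' n| <= tot / 4.
    by apply: small => // B; apply: nb; constructor 2.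
  have s3 : `|rectint P Q a' m n d'| <= tot / 4.
    by apply: small => // B; apply: nb; constructor 3.
  have s4 : `|rectint P Q m b' n d'| <= tot / 4.
    by apply: small => // B; apply: nb; constructor 4.
  rewrite E (le_trans (ler_normD _ _))//.
  have := ler_normD (rectint P Q a' m c' n) (rectint P Q m b' c' n).
  have := ler_normD (rectint P Q a' m n d') (rectint P Q m b' n d').
  by clear -s1 s2 s3 s4; lra.
- split; rewrite ?lexx ?ab ?cd//.
  rewrite /eta mulrAC ltr_pdivrMr; last by rewrite exprn_gt0// ltr_wpDl.
  have J1 : 0 < `|rectint P Q a b c d| by rewrite normr_gt0.
  by rewrite (ltr_pM2l J1); clear -w0; nra.
have [del del0 small] := rectint_small (cl x y xab ycd) eta0.
have [a' [b' [c' [d' [xab' ycd' ba dc]]]]] := H del del0.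
case=> aB bB cB dB.
have [aa' _] := andP aB; have [_ bb'] := andP bB.
have [cc' _] := andP cB; have [_ dd'] := andP dB.
rewrite ltNge (small _ _ _ _ xab' ycd' ba dc)//; [exact: contP|exact: contP|exact: contQ|exact: contQ].
Qed.

End goursat.

(** * Complex derivatives *)

Section complex_plane.
Context {R : realType}.
Local Notation C := R[i].
Implicit Types (z w l : C) (f g : C -> C).

Lemma normc_sqr z : nc z ^+ 2 = Re z ^+ 2 + Im z ^+ 2.
Proof. by case: z => x y /=; rewrite sqr_sqrtr// addr_ge0// sqr_ge0. Qed.

Lemma normc_ge0 z : 0 <= nc z.
Proof. by case: z => x y /=; rewrite sqrtr_ge0. Qed.

Lemma normcE_complex z : `|z| = (nc z)%:C%C.
Proof. by rewrite normc_def; case: z. Qed.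

Lemma le_normc_sqr z (r : R) : 0 <= r -> Re z ^+ 2 + Im z ^+ 2 <= r ^+ 2 -> nc z <= r.
Proof.
by move=> r0; rewrite -normc_sqr ler_sqr ?nnegrE// normc_ge0.
Qed.

Lemma ler_Re_normc z : `|Re z| <= nc z.
Proof.
rewrite -ler_sqr ?nnegrE ?normc_ge0// normc_sqr -normrX ger0_norm ?sqr_ge0//.
by rewrite lerDl sqr_ge0.
Qed.

Lemma ler_Im_normc z : `|Im z| <= nc z.
Proof.
rewrite -ler_sqr ?nnegrE ?normc_ge0// normc_sqr -normrX ger0_norm ?sqr_ge0//.
by rewrite lerDr sqr_ge0.
Qed.

Lemma normc_le_ReIm z : nc z <= `|Re z| + `|Im z|.
Proof.
apply: le_normc_sqr; first by rewrite addr_ge0.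
rewrite -(real_normK (num_real (Re z))) -(real_normK (num_real (Im z))).
have := normr_ge0 (Re z); have := normr_ge0 (Im z); nra.
Qed.

Lemma normcB z w : nc (z - w) = nc (w - z).
Proof. by rewrite -opprB normcN. Qed.

Lemma normc_gt0 z : (0 < nc z) = (z != 0).
Proof.
rewrite lt_def normc_ge0 andbT; congr (~~ _); apply/eqP/eqP => [|->].
  exact: eq0_normc.
exact: normc0.
Qed.

Lemma ler_dist_normc z w : `|nc z - nc w| <= nc (z - w).
Proof.
rewrite ler_norml; apply/andP; split.
  have := le_normcD (w - z) z; rewrite subrK (normcB w z); lra.
have := le_normcD (z - w) w; rewrite subrK; lra.
Qed.

(** The epsilon-delta form of f'(z) = l with real radii, which avoids the topology of the complex
numbers, where radii are themselves complex. *)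
Definition has_cderiv f z l := forall e : R, 0 < e ->
  exists2 del : R, 0 < del & forall h, nc h < del ->
    nc (f (z + h) - f z - l * h) <= e * nc h.

Lemma derivable_has_cderiv f z :
  derivable (f : C^o -> C^o) (z : C^o) (1 : C^o) <-> exists l, has_cderiv f z l.
Proof.
have quot (l h d : C) : h != 0 -> - (d - l * h) = (l - h^-1 * d) * h.
  by move=> h0; field.
split.
  move=> /cvg_ex[l /= /cvgrPdist_lt H]; exists l => e e0.
  have e0C : 0 < e%:C%C by rewrite ltcR.
  have := H _ e0C; rewrite near_withinE.
  move=> /nbhs_ballP[/= d d0 {}H].
  move: d0; rewrite ltcE /= => /andP[/eqP Imd Red].
  exists (Re d) => // h hd; have [->|h0] := eqVneq h 0.
    by rewrite addr0 mulr0 subrr subr0 normc0 mulr0.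
  have := H h; rewrite /ball/= sub0r normrN normcE_complex ltcE/= Imd eqxx hd.
  move=> /(_ isT h0); rewrite normcE_complex ltcR scaler1 [h + z]addrC => lt.
  rewrite -normcN (_ : - _ = (l - h^-1 * (f (z + h) - f z)) * h).
    by rewrite normcM ler_wpM2r ?normc_ge0//; exact: ltW.
  exact: (quot l h (f (z + h) - f z) h0).
move=> [l H]; apply/cvg_ex; exists l; apply/cvgrPdist_le => /= e.
rewrite ltcE/= => /andP[/eqP Ime Ree].
have [d d0 {}H] := H _ Ree; rewrite near_withinE.
apply/nbhs_ballP; exists d%:C%C; rewrite /= ?ltcR// => h.
rewrite /ball/= sub0r normrN normcE_complex ltcR => /H le h0.
rewrite normcE_complex lecE/= Ime eqxx/= scaler1 [h + z]addrC.
rewrite -(@ler_pM2r _ (nc h)) ?normc_gt0// -normcM.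
rewrite (_ : _ * h = - (f (z + h) - f z - l * h)) ?normcN//.
by rewrite quot.
Qed.

Lemma entireP f : entire f -> forall z, exists l, has_cderiv f z l.
Proof. by move=> ef z; apply/derivable_has_cderiv. Qed.

Lemma has_cderiv_entire f : (forall z, exists l, has_cderiv f z l) -> entire f.
Proof. by move=> H z; apply/derivable_has_cderiv. Qed.

Lemma entire_cst (c : C) : entire (fun=> c).
Proof. by move=> z; exact: derivable_cst. Qed.

Lemma entire_id : entire (fun z : C => z).
Proof. by move=> z; exact: derivable_id. Qed.

Lemma entireD f g : entire f -> entire g -> entire (fun z => f z + g z).
Proof. by move=> ef eg z; exact: (@derivableD _ _ _ (f : C^o -> C^o) g). Qed.

Lemma entireM f g : entire f -> entire g -> entire (fun z => f z * g z).
Proof. by move=> ef eg z; exact: (@derivableM _ _ (f : C^o -> C^o) g). Qed.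

Lemma entire_comp f g : entire f -> entire g -> entire (f \o g).
Proof.
move=> ef eg z; apply/derivable1_diffP; apply: (@differentiable_comp _ C^o C^o C^o); exact/derivable1_diffP.
Qed.

Lemma has_cderivMl f z l (c : C) : has_cderiv f z l -> has_cderiv (fun x => c * f x) z (c * l).
Proof.
move=> H e e0; have K0 : 0 < nc c + 1 by rewrite ltr_wpDl// normc_ge0.
have [|d d0 {}H] := H (e / (nc c + 1)); first by rewrite divr_gt0.
exists d => // h /H le.
rewrite (_ : _ - _ = c * (f (z + h) - f z - l * h)); last by ring.
rewrite normcM (le_trans (ler_wpM2l (normc_ge0 c) le))// mulrA.
rewrite ler_wpM2r ?normc_ge0// mulrCA ler_piMr ?(ltW e0)//.
by rewrite ler_pdivrMr// mul1r lerDl.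
Qed.

Lemma has_cderiv_lip f z l : has_cderiv f z l ->
  exists2 del : R, 0 < del & forall h, nc h < del ->
    nc (f (z + h) - f z) <= (nc l + 1) * nc h.
Proof.
move=> /(_ 1 ltr01)[d d0 H]; exists d => // h /H.
rewrite mul1r => le; rewrite -(subrK (l * h) (f (z + h) - f z)).
by rewrite (le_trans (le_normcD _ _))// normcM mulrDl mul1r addrC lerD2l.
Qed.

Lemma has_cderiv_cont f z l : has_cderiv f z l -> forall e : R, 0 < e ->
  exists2 del : R, 0 < del & forall h, nc h < del -> nc (f (z + h) - f z) <= e.
Proof.
move=> /has_cderiv_lip[d d0 H] e e0.
have K0 : 0 < nc l + 1 by rewrite ltr_wpDl// normc_ge0.
exists (Num.min d (e / (nc l + 1))); first by rewrite lt_min d0 divr_gt0.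
move=> h; rewrite lt_min ltr_pdivlMr// => /andP[/H le hK].
by rewrite (le_trans le)// mulrC ltW.
Qed.

Lemma entire_normc_cont f : entire f -> forall z (e : R), 0 < e ->
  exists2 del : R, 0 < del & forall w, nc (w - z) < del -> `|nc (f w) - nc (f z)| <= e.
Proof.
move=> ef z e e0; have [l fl] := entireP ef z.
have [d d0 H] := has_cderiv_cont fl e0; exists d => // w /H.
by rewrite [z + _]addrC subrK; apply: le_trans; exact: ler_dist_normc.
Qed.

Lemma entire_cont1 f y : entire f -> forall a b, cont_on a b (fun x => nc (f (x +i* y)%C)).
Proof.
move=> ef a b x _; apply: continuous_eps => e e0.
have [d d0 H] := entire_normc_cont ef (x +i* y)%C e0; exists d => // s sx.
apply: H; rewrite (le_lt_trans (normc_le_ReIm _))//= subrr normr0 addr0//.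
Qed.

Lemma entire_cont2 f x : entire f -> forall a b, cont_on a b (fun y => nc (f (x +i* y)%C)).
Proof.
move=> ef a b y _; apply: continuous_eps => e e0.
have [d d0 H] := entire_normc_cont ef (x +i* y)%C e0; exists d => // s sx.
apply: H; rewrite (le_lt_trans (normc_le_ReIm _))//= subrr normr0 add0r//.
Qed.

(** The Cauchy-Riemann equations: Im (h dz) = Im h dx + Re h dy is closed where h is complex
differentiable. *)
Lemma has_cderiv_closed h x y l : has_cderiv h (x +i* y)%C l ->
  closed_at (fun x y => Im (h (x +i* y)%C)) (fun x y => Re (h (x +i* y)%C)) x y.
Proof.
move=> H; exists (Im l), (Re l), (- Im l) => e e0.
have [d d0 {}H] := H _ e0; exists (d / 2); rewrite ?divr_gt0// => s t sx ty.
pose k := ((s - x) +i* (t - y))%C.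
have kle : nc k <= `|s - x| + `|t - y| by exact: normc_le_ReIm.
have le : nc (h ((x +i* y)%C + k) - h (x +i* y)%C - l * k) <= e * (`|s - x| + `|t - y|).
  rewrite (le_trans (H k _)) ?ler_pM2l// (le_lt_trans kle)//; lra.
have xyk : (x +i* y)%C + k = (s +i* t)%C by apply/eqP; rewrite eq_complex/=; apply/andP; split; apply/eqP; ring.
rewrite xyk in le.
have := le_trans (ler_Re_normc _) le; have := le_trans (ler_Im_normc _) le.
case: (h _) => u v; case: (h _) => u' v'; case: l {H le} => l1 l2 /= leI leR.
split; [move: leI|move: leR]; apply: le_trans; rewrite le_eqVlt; apply/orP; left; apply/eqP; congr `| _ |; ring.
Qed.

End complex_plane.

(** * Cauchy's inequality on the boundary of a rectangle *)

Lemma ltgt_neq (R : realType) (u v : R) : u < v \/ v < u -> u != v.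
Proof. by move=> ?; rewrite neq_lt; apply/orP. Qed.

Section punctured.
Context {R : realType}.
Context (P Q : R -> R -> R) (x0 y0 : R).
Context (cl : forall x y, (x != x0) || (y != y0) -> closed_at P Q x y).

Let contP a b y : y != y0 -> cont_on a b (P ^~ y).
Proof. by move=> yy x _; apply: (@closed_at_cont1 _ P Q); apply: cl; rewrite yy orbT. Qed.

Let contQ c d x : x != x0 -> cont_on c d (Q x).
Proof. by move=> xx y _; apply: (@closed_at_cont2 _ P Q); apply: cl; rewrite xx. Qed.

(** Cutting along the four lines through the sides of the inner square leaves rectangles that do
not contain the singular point, where Goursat's theorem applies. *)
Lemma rectint_ring a b c d r : 0 < r ->
  a <= x0 - r -> x0 + r <= b -> c <= y0 - r -> y0 + r <= d ->
  rectint P Q a b c d = rectint P Q (x0 - r) (x0 + r) (y0 - r) (y0 + r).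
Proof.
move=> r0 ar rb cr rd.
have [xa xl xr xb] : [/\ a != x0, x0 - r != x0, x0 + r != x0 & b != x0].
  by split; apply: ltgt_neq; lra.
have [yc yl yr yd] : [/\ c != y0, y0 - r != y0, y0 + r != y0 & d != y0].
  by split; apply: ltgt_neq; lra.
have x1 : a <= x0 - r <= b by lra.
have x2 : x0 - r <= x0 + r <= b by lra.
have y1 : c <= y0 - r <= d by lra.
have y2 : y0 - r <= y0 + r <= d by lra.
have strip1 a' b' : a' <= b' -> b' < x0 \/ x0 < a' -> rectint P Q a' b' c d = 0.
  move=> ab' off; apply: goursat => //; first by lra.
  move=> x y /andP[ax xb'] _; apply: cl; rewrite ltgt_neq//.
  by case: off => off; [left; exact: le_lt_trans off|right; exact: lt_le_trans ax].
have strip2 c' d' : c' <= d' -> d' < y0 \/ y0 < c' ->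
    rectint P Q (x0 - r) (x0 + r) c' d' = 0.
  move=> cd' off; apply: goursat => //; first by lra.
  move=> x y _ /andP[cy yd']; apply: cl; rewrite orbC ltgt_neq//.
  by case: off => off; [left; exact: le_lt_trans off|right; exact: lt_le_trans cy].
rewrite (rectint_split1 x1 (contP yc) (contP yd) (contQ xa) (contQ xl) (contQ xb)).
rewrite strip1 ?add0r; [|by lra|by lra].
rewrite (rectint_split1 x2 (contP yc) (contP yd) (contQ xl) (contQ xr) (contQ xb)).
rewrite [X in _ + X]strip1 ?addr0; [|by lra|by lra].
rewrite (rectint_split2 y1 (contP yc) (contP yl) (contP yd) (contQ xl) (contQ xr)).
rewrite strip2 ?add0r; [|by lra|by lra].
rewrite (rectint_split2 y2 (contP yl) (contP yr) (contP yd) (contQ xl) (contQ xr)).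
by rewrite [X in _ + X]strip2 ?addr0//; lra.
Qed.

(** A singularity that is o(1 / r) at distance r is invisible to the integral, since the boundary
of the square of half-side r has length 8 r. *)
Lemma rectint_punctured a b c d : a < x0 < b -> c < y0 < d ->
  (forall e : R, 0 < e -> exists2 del : R, 0 < del & forall r x y,
     0 < r < del -> `|x - x0| <= r -> `|y - y0| <= r ->
     r <= `|x - x0| \/ r <= `|y - y0| ->
     `|P x y| <= e / r /\ `|Q x y| <= e / r) ->
  rectint P Q a b c d = 0.
Proof.
move=> /andP[ax xb] /andP[cy yd] H.
apply/eqP; apply: contraT => J0.
(* the four sides contribute at most 8 times e, so that e = |J| / 10 is small enough *)
set J := rectint _ _ _ _ _ _ in J0 *; have e0 : 0 < `|J| / 10 by rewrite divr_gt0 ?normr_gt0.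
have [del del0 {}H] := H _ e0.
pose m := Num.min del (Num.min (Num.min (x0 - a) (b - x0)) (Num.min (y0 - c) (d - y0))).
have m0 : 0 < m by rewrite !lt_min del0 !subr_gt0 ax xb cy yd.
pose r := m / 2; have r0 : 0 < r by rewrite /r divr_gt0.
have rm : r < m by rewrite /r; lra.
move: (rm); rewrite {1}/m !lt_min => /and3P[rdel /andP[rax rxb] /andP[rcy ryd]].
have JE : J = rectint P Q (x0 - r) (x0 + r) (y0 - r) (y0 + r) by apply: rectint_ring; lra.
have B x y : `|x - x0| <= r -> `|y - y0| <= r ->
     r <= `|x - x0| \/ r <= `|y - y0| ->
     `|P x y| <= `|J| / 10 / r /\ `|Q x y| <= `|J| / 10 / r.
  by apply: H; rewrite r0.
have e1 (u : R) : r <= `|u - r - u|.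
  by rewrite addrAC subrr add0r normrN ler_norm.
have e2 (u : R) : r <= `|u + r - u| by rewrite addrAC subrr add0r ler_norm.
have near (u v : R) : u - r <= v <= u + r -> `|v - u| <= r.
  by move=> /andP[h1 h2]; clear -r0 h1 h2; rewrite ler_norml; lra.
have n1 (u : R) : `|u - r - u| <= r by apply: near; clear -r0; lra.
have n2 (u : R) : `|u + r - u| <= r by apply: near; clear -r0; lra.
have I1 : `|lineint (x0 - r) (x0 + r) (fun x => P x (y0 - r) - P x (y0 + r)) - 0 * (x0 + r - (x0 - r))|
   <= 2 * (`|J| / 10 / r) * (x0 + r - (x0 - r)).
  apply: lineint_near; first by clear -r0; lra.
    by apply: cont_onB; apply: contP; apply: ltgt_neq; clear -r0; lra.
  move=> x /near hx; rewrite subr0 (le_trans (ler_normB _ _))// mulr2n mulrDl mul1r lerD//.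
    by apply: (B _ _ hx (n1 _) _).1; right.
  by apply: (B _ _ hx (n2 _) _).1; right.
have I2 : `|lineint (y0 - r) (y0 + r) (fun y => Q (x0 + r) y - Q (x0 - r) y) - 0 * (y0 + r - (y0 - r))|
   <= 2 * (`|J| / 10 / r) * (y0 + r - (y0 - r)).
  apply: lineint_near; first by clear -r0; lra.
    by apply: cont_onB; apply: contQ; apply: ltgt_neq; clear -r0; lra.
  move=> y /near hy; rewrite subr0 (le_trans (ler_normB _ _))// mulr2n mulrDl mul1r lerD//.
    by apply: (B _ _ (n2 _) hy _).2; left.
  by apply: (B _ _ (n1 _) hy _).2; left.
move: I1 I2; rewrite !mul0r !subr0.
have -> : 2 * (`|J| / 10 / r) * (x0 + r - (x0 - r)) = 4 / 10 * `|J| by field; rewrite gt_eqF.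
have -> : 2 * (`|J| / 10 / r) * (y0 + r - (y0 - r)) = 4 / 10 * `|J| by field; rewrite gt_eqF.
move=> I1 I2; have J1 : 0 < `|J| by rewrite normr_gt0.
have : `|J| <= 4 / 10 * `|J| + 4 / 10 * `|J|.
  by rewrite {1}JE /rectint (le_trans (ler_normD _ _))// lerD.
by lra.
Qed.

End punctured.

Section cauchy.
Context {R : realType}.
Local Notation C := R[i].
Implicit Types (z w l : C) (f g : C -> C).

(** The arc length integral of |g| over the boundary, with opposite sides paired as in
[rectint]. *)
Definition bdint g (a b c d : R) : R :=
  lineint a b (fun x => nc (g (x +i* c)%C) + nc (g (x +i* d)%C)) +
  lineint c d (fun y => nc (g (b +i* y)%C) + nc (g (a +i* y)%C)).

Lemma derivable_difference_quotient g w (L : C) z : entire g -> z != w ->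
  exists l, has_cderiv (fun z => (g z - L * (z - w)) * ((z - w)^-1 * (z - w)^-1)) z l.
Proof.
move=> eg zw; apply/derivable_has_cderiv.
have e1 : entire (fun z : C => z - w).
  by apply: entireD; [exact: entire_id|exact: entire_cst].
have d1 : derivable (fun z : C^o => (z - w)^-1 : C^o) z 1.
  by apply: derivableV; [rewrite subr_eq0|exact: e1].
have e2 : entire (fun z : C => g z - L * (z - w)).
  have -> : (fun z : C => g z - L * (z - w)) = (fun z : C => g z + (- L) * (z - w)).
    by apply/funext => ?; rewrite mulNr.
  exact: (entireD eg (entireM (@entire_cst R (- L)) e1)).
apply: (@derivableM _ C^o (fun z : C^o => g z - L * (z - w) : C^o)
  (fun z : C^o => (z - w)^-1 * (z - w)^-1 : C^o)); first exact: e2.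
exact: (@derivableM _ C^o (fun z : C^o => (z - w)^-1 : C^o)).
Qed.

Lemma inv_complexE (u v : R) :
  ((u +i* v)%C)^-1 = ((u / (u ^+ 2 + v ^+ 2)) +i* (- (v / (u ^+ 2 + v ^+ 2))))%C.
Proof. by []. Qed.

(** h is g / (z - w)^2 minus the polar term L / (z - w). *)
Lemma cauchy_quotient_near g (x0 y0 L x y r : R) : 0 < r ->
  (x, y) != (x0, y0) ->
  r / 2 <= `|x - x0| \/ r / 2 <= `|y - y0| ->
  let h := (g (x +i* y)%C - L%:C%C * ((x +i* y)%C - (x0 +i* y0)%C)) *
    (((x +i* y)%C - (x0 +i* y0)%C)^-1 * ((x +i* y)%C - (x0 +i* y0)%C)^-1) in
  let D := (x - x0) ^+ 2 + (y - y0) ^+ 2 in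
  `|Im h - L * ((y - y0) / D)| <= 4 / r ^+ 2 * nc (g (x +i* y)%C) /\
  `|Re h + L * ((x - x0) / D)| <= 4 / r ^+ 2 * nc (g (x +i* y)%C).
Proof.
move=> r0 xy far h D.
pose k := (x +i* y)%C - (x0 +i* y0)%C.
have kE : k = ((x - x0) +i* (y - y0))%C by [].
have k0 : k != 0.
  rewrite subr_eq0; apply: contra xy => /eqP[-> ->]//.
have kfar : r / 2 <= nc k.
  case: far => h1; apply: (le_trans h1).
    exact: (ler_Re_normc k).
  exact: (ler_Im_normc k).
have hE : h = g (x +i* y)%C * (k^-1 * k^-1) - L%:C%C * k^-1.
  by rewrite /h -/k; field.
have le : nc (g (x +i* y)%C * (k^-1 * k^-1)) <= 4 / r ^+ 2 * nc (g (x +i* y)%C).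
  rewrite !normcM !normcV mulrC ler_wpM2r ?normc_ge0//.
  have nk : 0 < nc k by rewrite normc_gt0.
  rewrite -invfM -expr2 -[4 / _]invrK invf_div lef_pV2 ?posrE ?divr_gt0 ?exprn_gt0//.
  rewrite (_ : r ^+ 2 / 4 = (r / 2) ^+ 2); last by field.
  by rewrite lerXn2r// nnegrE; [rewrite divr_ge0// ltW|exact: ltW].
have -> : Im h - L * ((y - y0) / D) = Im (g (x +i* y)%C * (k^-1 * k^-1)).
  rewrite hE kE inv_complexE -/D /=.
  by case: (_ * _ in RHS) => u v /=; ring.
have -> : Re h + L * ((x - x0) / D) = Re (g (x +i* y)%C * (k^-1 * k^-1)).
  rewrite hE kE inv_complexE -/D /=.
  by case: (_ * _ in RHS) => u v /=; ring.
by split; apply: le_trans le; [exact: ler_Im_normc|exact: ler_Re_normc].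
Qed.

Lemma le_bdint_part (f1 f2 h : R -> R) (a b r L k : R) : 0 < r ->
  0 <= L -> r <= b - a -> cont_on a b h ->
  cont_on a b f1 -> cont_on a b f2 ->
  (forall x, a <= x <= b -> h x <= k * (f1 x + f2 x) - L / (2 * r)) ->
  lineint a b h <= k * lineint a b (fun x => f1 x + f2 x) - L / 2.
Proof.
move=> r0 L0 rba ch c1 c2 H.
have cc : cont_on a b (fun x => k * (f1 x + f2 x)) by apply: cont_onZ; exact: cont_onD.
apply: (@le_trans _ _ (lineint a b (fun x => k * (f1 x + f2 x) - L / (2 * r)))).
  by apply: le_lineint => //; apply: cont_onB => //; exact: cont_on_cst.
rewrite (lineintD cc) ?lineintZ//; [|exact: cont_onD|exact: cont_on_cst].
rewrite lineint_cst; last by rewrite -subr_ge0 (le_trans _ rba)// ltW.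
rewrite lerD2l mulNr lerN2 (_ : L / 2 = L / (2 * r) * r); last by field; rewrite gt_eqF.
by rewrite ler_wpM2l// divr_ge0// mulr_ge0// ltW.
Qed.

(** The form Im (h dz), for h z = (g z - L (z - w)) / (z - w)^2, integrates to zero over the
boundary, since h is o(1 / |z - w|) at w. The pole of L / (z - w) contributes with a constant sign
on each side, at least L / (4 r) per unit of length, so that L is bounded by the contribution of
g / (z - w)^2. This replaces the computation of the integral of dz / (z - w). *)
Lemma cauchy_bound_real g (x0 y0 L a b c d r : R) : entire g ->
  g (x0 +i* y0)%C = 0 -> has_cderiv g (x0 +i* y0)%C L%:C%C -> 0 <= L -> 0 < r ->
  r / 2 <= x0 - a <= r -> r / 2 <= b - x0 <= r ->
  r / 2 <= y0 - c <= r -> r / 2 <= d - y0 <= r ->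
  L <= 4 / r ^+ 2 * bdint g a b c d.
Proof.
move=> eg g0 gL L0 r0 /andP[a1 a2] /andP[b1 b2] /andP[c1 c2] /andP[d1 d2].
set w := (x0 +i* y0)%C in g0 gL.
pose h z := (g z - L%:C%C * (z - w)) * ((z - w)^-1 * (z - w)^-1).
pose P x y := Im (h (x +i* y)%C); pose Q x y := Re (h (x +i* y)%C).
have cl x y : (x != x0) || (y != y0) -> closed_at P Q x y.
  move=> xy; have zw : (x +i* y)%C != w.
    by rewrite eq_complex /= -negb_and in xy *.
  have [l hl] := derivable_difference_quotient L%:C%C eg zw.
  exact: has_cderiv_closed hl.
have J0 : rectint P Q a b c d = 0.
  apply: (@rectint_punctured _ P Q x0 y0) => //; [lra|lra|].
  move=> e e0; have [del del0 H] := gL _ e0.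
  exists (del / 2); first by rewrite divr_gt0.
  move=> rho x y /andP[rho0 rhod] xr yr far.
  pose k := ((x - x0) +i* (y - y0))%C.
  have kle : nc k < del by rewrite (le_lt_trans (normc_le_ReIm _))//=; lra.
  have rk : rho <= nc k.
    by case: far => /le_trans; apply; [exact: (ler_Re_normc k)|exact: (ler_Im_normc k)].
  have zE : (x +i* y)%C = w + k.
    by apply/eqP; rewrite eq_complex/=; apply/andP; split; apply/eqP; ring.
  have hle : nc (h (x +i* y)%C) <= e / rho.
    rewrite /h zE (addrC w) addrK !normcM !normcV.
    have nk : 0 < nc k by rewrite (lt_le_trans rho0).
    have := H k kle; rewrite g0 subr0 (addrC w) => le.
    rewrite mulrA (le_trans (_ : _ <= e / nc k))//.
      by rewrite ler_wpM2r ?invr_ge0 ?normc_ge0// ler_pdivrMr.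
    by rewrite ler_wpM2l ?(ltW e0)// lef_pV2.
  by split; apply: le_trans hle; [exact: ler_Im_normc|exact: ler_Re_normc].
have contP a' b' y : y != y0 -> cont_on a' b' (P ^~ y).
  by move=> yy x _; apply: (@closed_at_cont1 _ P Q); apply: cl; rewrite yy orbT.
have contQ c' d' x : x != x0 -> cont_on c' d' (Q x).
  by move=> xx y _; apply: (@closed_at_cont2 _ P Q); apply: cl; rewrite xx.
have ker (u v : R) : r / 2 <= v <= r -> - r <= u <= r ->
    L / (4 * r) <= L * (v / (u ^+ 2 + v ^+ 2)).
  move=> /andP[v1 v2] /andP[u1 u2]; rewrite ler_wpM2l//.
  have v0 : 0 < v by lra.
  have D0 : 0 < u ^+ 2 + v ^+ 2 by rewrite ltr_wpDl ?sqr_ge0// exprn_gt0.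
  rewrite ler_pdivlMr// mulrC ler_pdivrMr ?mulr_gt0//; nra.
have quot x y : (x, y) != (x0, y0) -> r / 2 <= `|x - x0| \/ r / 2 <= `|y - y0| ->
   let D := (x - x0) ^+ 2 + (y - y0) ^+ 2 in
  `|P x y - L * ((y - y0) / D)| <= 4 / r ^+ 2 * nc (g (x +i* y)%C) /\
  `|Q x y + L * ((x - x0) / D)| <= 4 / r ^+ 2 * nc (g (x +i* y)%C).
  exact: cauchy_quotient_near.
have I1 : lineint a b (fun x => P x c - P x d) <=
    4 / r ^+ 2 * lineint a b (fun x => nc (g (x +i* c)%C) + nc (g (x +i* d)%C)) - L / 2.
  apply: (@le_bdint_part _ _ _ _ _ r) => //.
  - by lra.
  - by apply: cont_onB; apply: contP; apply: ltgt_neq; lra.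
  - exact: entire_cont1.
  - exact: entire_cont1.
  move=> x /andP[ax xb].
  have [||H1 _] := quot x c; first by rewrite xpair_eqE negb_and (@ltgt_neq _ c y0) ?orbT//; lra.
    by right; rewrite ler_normr; apply/orP; right; lra.
  have [||H2 _] := quot x d; first by rewrite xpair_eqE negb_and (@ltgt_neq _ d y0) ?orbT//; lra.
    by right; rewrite ler_normr; apply/orP; left; lra.
  move: H1 H2; rewrite !ler_norml => /andP[_ H1] /andP[H2 _].
  have k1 : L / (4 * r) <= L * ((y0 - c) / ((x - x0) ^+ 2 + (y0 - c) ^+ 2)).
    by apply: ker; lra.
  have k2 : L / (4 * r) <= L * ((d - y0) / ((x - x0) ^+ 2 + (d - y0) ^+ 2)).
    by apply: ker; lra.
  have e1 : L * ((c - y0) / ((x - x0) ^+ 2 + (c - y0) ^+ 2)) =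
      - (L * ((y0 - c) / ((x - x0) ^+ 2 + (y0 - c) ^+ 2))).
    by rewrite -(opprB y0 c) sqrrN mulNr mulrN.
  have e2 : L / (2 * r) = L / (4 * r) + L / (4 * r) by field; rewrite gt_eqF.
  by rewrite e1 in H1; rewrite e2; lra.
have I2 : lineint c d (fun y => Q b y - Q a y) <=
    4 / r ^+ 2 * lineint c d (fun y => nc (g (b +i* y)%C) + nc (g (a +i* y)%C)) - L / 2.
  apply: (@le_bdint_part _ _ _ _ _ r) => //.
  - by lra.
  - by apply: cont_onB; apply: contQ; apply: ltgt_neq; lra.
  - exact: entire_cont2.
  - exact: entire_cont2.
  move=> y /andP[cy yd].
  have [||_ H1] := quot b y; first by rewrite xpair_eqE negb_and (@ltgt_neq _ b x0)//; lra.
    by left; rewrite ler_normr; apply/orP; left; lra.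
  have [||_ H2] := quot a y; first by rewrite xpair_eqE negb_and (@ltgt_neq _ a x0)//; lra.
    by left; rewrite ler_normr; apply/orP; right; lra.
  move: H1 H2; rewrite !ler_norml => /andP[_ H1] /andP[H2 _].
  have k1 : L / (4 * r) <= L * ((b - x0) / ((b - x0) ^+ 2 + (y - y0) ^+ 2)).
    by rewrite [X in _ <= L * (_ / X)]addrC; apply: ker; lra.
  have k2 : L / (4 * r) <= L * ((x0 - a) / ((x0 - a) ^+ 2 + (y - y0) ^+ 2)).
    by rewrite [X in _ <= L * (_ / X)]addrC; apply: ker; lra.
  have e1 : L * ((a - x0) / ((a - x0) ^+ 2 + (y - y0) ^+ 2)) =
      - (L * ((x0 - a) / ((x0 - a) ^+ 2 + (y - y0) ^+ 2))).
    by rewrite -(opprB x0 a) sqrrN mulNr mulrN.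
  have e2 : L / (2 * r) = L / (4 * r) + L / (4 * r) by field; rewrite gt_eqF.
  by rewrite e1 in H2; rewrite e2; lra.
rewrite -subr_ge0 -[X in X <= _]J0 /rectint /bdint mulrDr.
by rewrite (le_trans (lerD I1 I2))//; lra.
Qed.

Lemma conjc_mul_self l : (l^*)%C * l = (nc l ^+ 2)%:C%C.
Proof.
rewrite normc_sqr; case: l => u v /=.
by apply/eqP; rewrite eq_complex/=; apply/andP; split; apply/eqP; ring.
Qed.

Lemma bdintZ g (k : C) (a b c d : R) : entire g ->
  bdint (fun z => k * g z) a b c d = nc k * bdint g a b c d.
Proof.
move=> eg; rewrite /bdint mulrDr -!lineintZ; first last.
- by apply: cont_onD; exact: entire_cont1.
- by apply: cont_onD; exact: entire_cont2.
by congr (_ + _); apply: eq_lineint => x _; rewrite !normcM; ring.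
Qed.

(** Multiplying g by the conjugate of l makes the derivative at w a nonnegative real number, the
case of [cauchy_bound_real]. *)
Theorem cauchy_bound g (x0 y0 a b c d r : R) l : entire g ->
  g (x0 +i* y0)%C = 0 -> has_cderiv g (x0 +i* y0)%C l -> 0 < r ->
  r / 2 <= x0 - a <= r -> r / 2 <= b - x0 <= r ->
  r / 2 <= y0 - c <= r -> r / 2 <= d - y0 <= r ->
  nc l <= 4 / r ^+ 2 * bdint g a b c d.
Proof.
move=> eg g0 gl r0 ra rb rc rd.
have [->|l0] := eqVneq l 0.
  rewrite normc0 mulr_ge0//.
    by rewrite divr_ge0// exprn_ge0// ltW.
  by rewrite addr_ge0//; apply: Rintegral_ge0 => ? _; rewrite addr_ge0// normc_ge0.
have nl : 0 < nc l by rewrite normc_gt0.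
rewrite -(ler_pM2l nl) mulrCA -(_ : nc (l^*)%C = nc l); last first.
  by case: (l) => u v /=; rewrite sqrrN.
rewrite -bdintZ// (_ : nc (l^*)%C = nc l); last by case: (l) => u v /=; rewrite sqrrN.
have eg' := entireM (@entire_cst R (l^*)%C) eg.
have gl' := has_cderivMl (l^*)%C gl; rewrite conjc_mul_self in gl'.
have g0' : (l^*)%C * g (x0 +i* y0)%C = 0 by rewrite g0 mulr0.
have n0 : 0 <= nc l ^+ 2 by rewrite exprn_ge0// ltW.
by rewrite -expr2; exact: (cauchy_bound_real eg' g0' gl' n0 r0 ra rb rc rd).
Qed.

End cauchy.

(** * Cauchy estimates and mean values *)

Section cauchy_estimates.
Context {R : realType}.
Local Notation C := R[i].
Implicit Types (z w l : C) (f g : C -> C).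

Lemma bdint_le f (a b c d S : R) : entire f -> a <= b -> c <= d ->
  (forall x y, a <= x <= b -> c <= y <= d -> nc (f (x +i* y)%C) <= S) ->
  bdint f a b c d <= 2 * S * (b - a + (d - c)).
Proof.
move=> ef ab cd H; rewrite mulrDr lerD//.
  rewrite -lineint_cst//; apply: le_lineint.
  - by apply: cont_onD; exact: entire_cont1.
  - exact: cont_on_cst.
  by move=> x ?; rewrite mulrDl mul1r lerD// H// lexx cd.
rewrite -lineint_cst//; apply: le_lineint.
- by apply: cont_onD; exact: entire_cont2.
- exact: cont_on_cst.
by move=> x ?; rewrite mulrDl mul1r lerD// H// lexx ab.
Qed.

Lemma cderiv_bound f (x0 y0 r S : R) l : entire f -> 0 < r ->
  (forall x y, `|x - x0| <= r -> `|y - y0| <= r -> nc (f (x +i* y)%C) <= S) ->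
  has_cderiv f (x0 +i* y0)%C l -> nc l <= 64 * S / r.
Proof.
move=> ef r0 fS fl; pose w := (x0 +i* y0)%C.
have eg : entire (fun z => f z - f w) := entireD ef (@entire_cst R (- f w)).
have gl : has_cderiv (fun z => f z - f w) w l.
  move=> e e0; have [d d0 H] := fl _ e0; exists d => // h /H.
  by rewrite subrr subr0.
have := @cauchy_bound _ _ x0 y0 (x0 - r) (x0 + r) (y0 - r) (y0 + r) r l eg _ gl r0.
rewrite subrr => /(_ erefl) H.
have {}H : nc l <= 4 / r ^+ 2 * bdint (fun z => f z - f w) (x0 - r) (x0 + r) (y0 - r) (y0 + r).
  by apply: H; lra.
rewrite (le_trans H)// (_ : 64 * S / r = 4 / r ^+ 2 * (2 * (S + S) * (x0 + r - (x0 - r) + (y0 + r - (y0 - r))))); last first.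
  by field; rewrite gt_eqF.
rewrite ler_wpM2l ?divr_ge0 ?exprn_ge0 ?(ltW r0)//.
apply: bdint_le => //; try lra.
move=> x y xr yr; rewrite (le_trans (le_normcD _ _))// normcN lerD//.
  by apply: fS; rewrite ler_norml; lra.
by apply: fS; rewrite subrr normr0 ltW.
Qed.

(** By bisection of [0, 1] rather than by the real mean value theorem, which would need to be
applied to a real-valued function built from f. The second coordinate of the bisected rectangle is
degenerate. *)
Lemma mean_value_ineq f z w (L : R) :
  (forall t : R, 0 <= t <= 1 ->
     exists2 l, has_cderiv f (w + t%:C%C * (z - w)) l & nc l <= L) ->
  nc (f z - f w) <= L * nc (z - w).
Proof.
move=> fL; have [->|zw] := eqVneq z w.
  by rewrite !subrr normc0 mulr0.
set n := nc (z - w); have n0 : 0 < n by rewrite normc_gt0 subr_eq0.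
rewrite leNgt; apply/negP => big.
pose F := nc (f z - f w); pose eta := (F - L * n) / (2 * n).
have eta0 : 0 < eta by rewrite divr_gt0 ?subr_gt0// mulr_gt0.
pose ga (t : R) := w + t%:C%C * (z - w).
have gaB s t : nc (ga t - ga s) = `|t - s| * n.
  rewrite (_ : ga t - ga s = (t - s)%:C%C * (z - w)).
    rewrite normcM; congr (_ * _).
    by rewrite /= expr0n addr0 sqrtr_sqr.
  by rewrite /ga rmorphB/=; ring.
pose Bad (a b c d : R) := [/\ 0 <= a, b <= 1 & (L + eta) * n * (b - a) < nc (f (ga b) - f (ga a))].
have [||t [y0 [/andP[t0 t1] _ H]]] := @bisection R Bad 0 1 0 0 ler01 (lexx 0).
- move=> a b c d ab cd [a0 b1 ba]; set m := (a + b) / 2.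
  have am : a <= m by rewrite /m; lra.
  have mb : m <= b by rewrite /m; lra.
  apply: contrapT => nb.
  have s1 : nc (f (ga m) - f (ga a)) <= (L + eta) * n * (m - a).
    by rewrite leNgt; apply/negP => h; apply: nb; constructor 1; split => //; lra.
  have s2 : nc (f (ga b) - f (ga m)) <= (L + eta) * n * (b - m).
    by rewrite leNgt; apply/negP => h; apply: nb; constructor 2; split => //; lra.
  have := le_normcD (f (ga b) - f (ga m)) (f (ga m) - f (ga a)).
  by rewrite addrA subrK; lra.
- split => //; rewrite /ga rmorph1 mul1r rmorph0 mul0r addr0 subr0 mulr1 [w + _]addrC subrK.
  rewrite -/F in big *; rewrite mulrDl /eta (_ : _ / _ * n = (F - L * n) / 2); first lra.
  by field; rewrite gt_eqF.
have [|l fl lL] := fL t; first by rewrite t0.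
have [del del0 D] := fl _ eta0.
have [a [b [_ [_ [/andP[at_ tb] _ bd _ [a0 b1]]]]]] := H (del / n) (divr_gt0 del0 n0).
rewrite ltr_pdivlMr// in bd.
have D' s : a <= s <= b -> nc (f (ga s) - f (ga t)) <= (L + eta) * n * `|s - t|.
  move=> /andP[a_s sb].
  have st : nc (ga s - ga t) < del.
    rewrite gaB (le_lt_trans _ bd)// ler_wpM2r ?(ltW n0)//.
    by rewrite ler_norml; lra.
  have := D _ st; rewrite (addrC (ga t)) subrK => le.
  rewrite -[X in nc X](subrK (l * (ga s - ga t))).
  rewrite gaB in le; rewrite (le_trans (le_normcD _ _))// normcM gaB.
  rewrite (le_trans (lerD le (lexx _)))// -mulrDl addrC (mulrC _ n) mulrA.
  by rewrite ler_wpM2r// ler_wpM2r ?(ltW n0)// lerD2r.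
have h1 : nc (f (ga b) - f (ga t)) <= (L + eta) * n * (b - t).
  by have := D' b; rewrite ger0_norm ?subr_ge0//; apply; lra.
have h2 : nc (f (ga a) - f (ga t)) <= (L + eta) * n * (t - a).
  by have := D' a; rewrite distrC ger0_norm ?subr_ge0//; apply; lra.
have := le_normcD (f (ga b) - f (ga t)) (f (ga t) - f (ga a)).
rewrite addrA subrK (normcB (f (ga t))); lra.
Qed.

(** [cauchy_bound] for (z - w) f z, whose derivative at w is f w. *)
Lemma submean f (x0 y0 a b c d r : R) : entire f -> 0 < r ->
  r / 2 <= x0 - a <= r -> r / 2 <= b - x0 <= r ->
  r / 2 <= y0 - c <= r -> r / 2 <= d - y0 <= r ->
  nc (f (x0 +i* y0)%C) <= 8 / r * bdint f a b c d.
Proof.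
move=> ef r0 ra rb rc rd; pose w := (x0 +i* y0)%C.
have eg : entire (fun z => (z - w) * f z) :=
  entireM (entireD (@entire_id R) (@entire_cst R (- w))) ef.
have gl : has_cderiv (fun z => (z - w) * f z) w (f w).
  have [l fl] := entireP ef w.
  move=> e e0; have [d' d0 H] := has_cderiv_cont fl e0; exists d' => // h /H le.
  rewrite subrr mul0r subr0 (addrC w) addrK (addrC h).
  rewrite (_ : _ - _ = h * (f (w + h) - f w)); last by ring.
  by rewrite normcM mulrC ler_wpM2r// normc_ge0.
have := @cauchy_bound _ _ x0 y0 a b c d r (f w) eg _ gl r0.
rewrite subrr mul0r => /(_ erefl ra rb rc rd) H; rewrite (le_trans H)//.
have -> : 8 / r * bdint f a b c d = 4 / r ^+ 2 * (2 * r * bdint f a b c d).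
  by field; rewrite gt_eqF.
rewrite ler_wpM2l ?divr_ge0 ?exprn_ge0 ?(ltW r0)//.
have near_w x y : a <= x <= b -> c <= y <= d ->
    nc (((x +i* y)%C - w) * f (x +i* y)%C) <= 2 * r * nc (f (x +i* y)%C).
  move=> /andP[? ?] /andP[? ?]; rewrite normcM ler_wpM2r ?normc_ge0//.
  rewrite (le_trans (normc_le_ReIm _))//= mulrDl mul1r lerD// ler_norml; lra.
rewrite mulrDr lerD// -lineintZ; try (by apply: cont_onD; exact: entire_cont1);
  try (by apply: cont_onD; exact: entire_cont2).
  apply: le_lineint.
  - exact: (cont_onD (@entire_cont1 _ _ c eg a b) (@entire_cont1 _ _ d eg a b)).
  - by apply: cont_onZ; apply: cont_onD; exact: entire_cont1.
  by move=> x ?; rewrite mulrDr lerD// near_w// lexx/=; lra.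
apply: le_lineint.
- exact: (cont_onD (@entire_cont2 _ _ b eg c d) (@entire_cont2 _ _ a eg c d)).
- by apply: cont_onZ; apply: cont_onD; exact: entire_cont2.
by move=> x ?; rewrite mulrDr lerD// near_w// lexx/=; lra.
Qed.

End cauchy_estimates.

(** * Area mean values *)

Section plane_measurability.
Context {R : realType}.
Local Notation C := R[i].

(** The superlevel sets of G are unions of rational boxes. *)
Lemma continuous_plane_measurable (G : R * R -> R) :
  (forall x y e : R, 0 < e -> exists2 del : R, 0 < del & forall s t,
     `|s - x| < del -> `|t - y| < del -> `|G (s, t) - G (x, y)| <= e) ->
  measurable_fun setT G.
Proof.
move=> cG; apply: (measurability _ (measurable_realfun.RGenOInfty.measurableE R)).
move=> _ [_ [a ->] <-]; rewrite setTI.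
pose box (q1 q2 q3 q4 : rat) : set (R * R) :=
  `](ratr q1), (ratr q2)[%classic `*` `](ratr q3), (ratr q4)[%classic.
have -> : G @^-1` `]a, +oo[%classic = \bigcup_q1 \bigcup_q2 \bigcup_q3 \bigcup_q4
    (if `[< box q1 q2 q3 q4 `<=` G @^-1` `]a, +oo[%classic >] then box q1 q2 q3 q4 else set0).
  apply/seteqP; split => [[x y] /=|[x y] [q1 _ [q2 _ [q3 _ [q4 _]]]]]; last first.
    by case: asboolP => // sub; exact: sub.
  rewrite in_itv/= andbT => aG.
  have e0 : 0 < (G (x, y) - a) / 2 by rewrite divr_gt0// subr_gt0.
  have [del del0 H] := cG x y _ e0.
  have rl (u : R) : exists q : rat, u - del < ratr q < u.
    have : u - del < u by rewrite ltrBlDr ltrDl.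
    by move=> /rat_in_itvoo[q]; rewrite in_itv; exists q.
  have rr (u : R) : exists q : rat, u < ratr q < u + del.
    have : u < u + del by rewrite ltrDl.
    by move=> /rat_in_itvoo[q]; rewrite in_itv; exists q.
  have [q1 /andP[q1l q1r]] := rl x; have [q2 /andP[q2l q2r]] := rr x.
  have [q3 /andP[q3l q3r]] := rl y; have [q4 /andP[q4l q4r]] := rr y.
  exists q1 => //; exists q2 => //; exists q3 => //; exists q4 => //.
  case: asboolP => [_|]; first by split; rewrite /= in_itv/= ?q1r ?q2l ?q3r ?q4l.
  case=> -[s t] [/=]; rewrite !in_itv/= andbT => /andP[s1 s2] /andP[t1 t2].
  have : `|G (s, t) - G (x, y)| <= (G (x, y) - a) / 2.
    by apply: H; rewrite ltr_norml; lra.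
  by rewrite ler_norml; lra.
do 4! apply: bigcupT_measurable_rat => ?.
case: ifP => _ //; apply: measurableX; exact: measurable_itv.
Qed.

Lemma entire_normc_measurable (f : C -> C) : entire f ->
  measurable_fun setT (fun xy : R * R => nc (f (complex_of_pair xy))).
Proof.
move=> ef; apply: continuous_plane_measurable => x y e e0.
have [d d0 H] := entire_normc_cont ef (x +i* y)%C e0.
exists (d / 2); first by rewrite divr_gt0.
move=> s t sx ty; apply: H; rewrite (le_lt_trans (normc_le_ReIm _))//=; lra.
Qed.

End plane_measurability.

Section line_selection.
Context {R : realType}.
Local Notation C := R[i].

Lemma lt_integral_selection (U : R -> \bar R) (al be K : R) :
  measurable_fun setT U -> (forall y, 0 <= U y)%E ->
  (\int[mu]_y U y <= K%:E)%E -> 0 <= K -> al < be ->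
  exists2 y, al <= y <= be & (U y <= ((K + 1) / (be - al))%:E)%E.
Proof.
move=> mU U0 UK K0 ab; apply: contrapT => nex.
have big y : al <= y <= be -> (((K + 1) / (be - al))%:E < U y)%E.
  by move=> yab; rewrite ltNge; apply/negP => h; apply: nex; exists y.
have : (\int[mu]_(y in `[al, be]) ((K + 1) / (be - al))%:E <= \int[mu]_y U y)%E.
  apply: (@le_trans _ _ (\int[mu]_(y in `[al, be]) U y)%E); last first.
    by apply: ge0_subset_integral => // y _; exact: U0.
  apply: ge0_le_integral => //.
  - by move=> y _; rewrite lee_fin divr_ge0// ?subr_ge0 ?(ltW ab)// addr_ge0.
  - exact: measurable_funTS.
  - by move=> y; rewrite /= in_itv/= => /big/ltW.
rewrite integral_cst//= lebesgue_measure_itv/= lte_fin ab -EFinB -EFinM.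
rewrite divfK ?gt_eqF ?subr_gt0// => /le_trans /(_ UK).
by rewrite lee_fin leNgt ltrDl ltr01.
Qed.

Context (G : R * R -> R) (K : R).
Context (mG : measurable_fun setT G) (G0 : forall xy, 0 <= G xy) (K0 : 0 <= K).
Context (GK : (\int[(mu \x mu)%E]_xy (G xy)%:E <= K%:E)%E).

Let mGE : measurable_fun setT (EFin \o G).
Proof. exact/measurable_EFinP. Qed.

Let G0E xy : (0 <= (EFin \o G) xy)%E.
Proof. by rewrite /= lee_fin. Qed.

Lemma vertical_line_selection (al be : R) : al < be -> exists2 x, al <= x <= be &
  (\int[mu]_y (G (x, y))%:E <= ((K + 1) / (be - al))%:E)%E.
Proof.
apply: (@lt_integral_selection (fubini_F mu (EFin \o G))) => //.
- exact: measurable_fun_fubini_tonelli_F.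
- by move=> x; apply: integral_ge0 => y _; rewrite lee_fin.
- by rewrite -(fubini_tonelli1 (m1 := mu)).
Qed.

Lemma horizontal_line_selection (al be : R) : al < be -> exists2 y, al <= y <= be &
  (\int[mu]_x (G (x, y))%:E <= ((K + 1) / (be - al))%:E)%E.
Proof.
apply: (@lt_integral_selection (fubini_G mu (EFin \o G))) => //.
- exact: measurable_fun_fubini_tonelli_G.
- by move=> x; apply: integral_ge0 => y _; rewrite lee_fin.
- by rewrite -(fubini_tonelli2 (m2 := mu)).
Qed.

Lemma lineint_le_ereal (a b S lam : R) (f h : R -> R) :
  a <= b -> 0 <= S -> cont_on a b f -> (forall x, 0 <= f x) ->
  measurable_fun setT h -> (forall x, 0 <= h x) ->
  (forall x, a <= x <= b -> f x <= S * (1 + h x)) ->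
  (\int[mu]_x (h x)%:E <= lam%:E)%E ->
  lineint a b f <= S * (b - a + lam).
Proof.
move=> ab S0 cf f0 mh h0 H hl.
have intf := cont_on_integrable cf.
have fin : (\int[mu]_(x in `[a, b]) (f x)%:E)%E \is a fin_num.
  exact: integrable_fin_num.
rewrite -lee_fin /lineint /Rintegral fineK//.
apply: (@le_trans _ _ (\int[mu]_(x in `[a, b]) (S%:E * (1 + h x)%:E))%E).
  apply: ge0_le_integral => //.
  - by move=> x _; rewrite lee_fin.
  - exact: (measurable_int mu).
  - apply/measurable_funTS/measurable_EFinP; apply: measurable_funM => //.
    exact: measurable_funD.
have m1 : measurable_fun setT (fun x => (1 + h x)%:E).
  by apply/measurable_EFinP; exact: measurable_funD.
rewrite ge0_integralZl_EFin//; first last.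
- exact: measurable_funTS.
- by move=> x _; rewrite lee_fin addr_ge0.
rewrite EFinM; apply: lee_wpmul2l; first by rewrite lee_fin.
under eq_integral do rewrite EFinD.
rewrite ge0_integralD//; first last.
- by apply/measurable_funTS/measurable_EFinP.
- by move=> x _; rewrite lee_fin.
rewrite EFinD; apply: leeD.
  rewrite integral_cst//= mul1e lebesgue_measure_itv/= lte_fin.
  by have [_|ba] := ltP a b => //; rewrite lee_fin subr_ge0.
apply: le_trans hl; apply: ge0_subset_integral => //.
- exact/measurable_EFinP.
- by move=> x _; rewrite lee_fin.
Qed.

(** The majorant G is kept apart from |f|: it will be the density of F^p of a multiple of f, while
the factor S absorbs the size of |f| when p < 1. *)
Lemma submean_area (f : C -> C) (x0 y0 r S : R) : entire f -> 0 < r -> 0 <= S ->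
  (forall x y, `|x - x0| <= r -> `|y - y0| <= r ->
     nc (f (x +i* y)%C) <= S * (1 + G (x, y))) ->
  nc (f (x0 +i* y0)%C) <= 64 * S * (1 + (K + 1) / r ^+ 2).
Proof.
move=> ef r0 S0 H.
(* one good line in each of the four strips between the squares of radius r / 2 and r *)
have [|a /andP[a1 a2] aG] := @vertical_line_selection (x0 - r) (x0 - r / 2); first by lra.
have [|b /andP[b1 b2] bG] := @vertical_line_selection (x0 + r / 2) (x0 + r); first by lra.
have [|c /andP[c1 c2] cG] := @horizontal_line_selection (y0 - r) (y0 - r / 2); first by lra.
have [|d /andP[d1 d2] dG] := @horizontal_line_selection (y0 + r / 2) (y0 + r); first by lra.
have e1 (u : R) : u - r / 2 - (u - r) = r / 2 by field.
have e2 (u : R) : u + r - (u + r / 2) = r / 2 by field.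
rewrite !e1 in aG cG; rewrite !e2 in bG dG.
set lam := (K + 1) / (r / 2) in aG bG cG dG.
have lam0 : 0 <= lam by rewrite divr_ge0 ?addr_ge0// divr_ge0// ltW.
have ab : a <= b by lra.
have cd : c <= d by lra.
have h1 y : y0 - r <= y <= y0 + r -> (\int[mu]_x (G (x, y))%:E <= lam%:E)%E ->
    lineint a b (fun x => nc (f (x +i* y)%C)) <= S * (2 * r + lam).
  move=> /andP[yl yr] yG.
  apply: (@le_trans _ _ (S * (b - a + lam))); last by rewrite ler_wpM2l//; lra.
  apply: (@lineint_le_ereal _ _ _ _ _ (fun x => G (x, y))) => //.
  - exact: entire_cont1.
  - by move=> x; exact: normc_ge0.
  - by apply: measurableT_comp => //.
  - by move=> x /andP[? ?]; apply: H; rewrite ler_norml; lra.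
have h2 x : x0 - r <= x <= x0 + r -> (\int[mu]_y (G (x, y))%:E <= lam%:E)%E ->
    lineint c d (fun y => nc (f (x +i* y)%C)) <= S * (2 * r + lam).
  move=> /andP[xl xr] yG.
  apply: (@le_trans _ _ (S * (d - c + lam))); last by rewrite ler_wpM2l//; lra.
  apply: (@lineint_le_ereal _ _ _ _ _ (fun y => G (x, y))) => //.
  - exact: entire_cont2.
  - by move=> y; exact: normc_ge0.
  - by apply: measurableT_comp => //.
  - by move=> y /andP[? ?]; apply: H; rewrite ler_norml; lra.
have sm : nc (f (x0 +i* y0)%C) <= 8 / r * bdint f a b c d.
  by apply: submean => //; lra.
rewrite (le_trans sm)//.
have -> : 64 * S * (1 + (K + 1) / r ^+ 2) = 8 / r * (4 * (S * (2 * r + lam))).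
  by rewrite /lam; field; rewrite gt_eqF.
rewrite ler_wpM2l ?divr_ge0// ?(ltW r0)//.
rewrite /bdint !lineintD; try exact: entire_cont1; try exact: entire_cont2.
have := h1 c _ cG; have := h1 d _ dG; have := h2 a _ aG; have := h2 b _ bG.
by move=> ha hb hc hd; have := ha; have := hb; have := hc; have := hd; lra.
Qed.

End line_selection.

(** * Local bounds by p-th powers *)

Lemma le_powR (R : realType) (r a b : R) : 0 <= r -> 0 <= a -> a <= b -> a `^ r <= b `^ r.
Proof.
by move=> r0 a0 ab; apply: ge0_ler_powR; rewrite ?nnegrE ?(le_trans a0 ab).
Qed.

Section local_bound.
Context {R : realType}.
Local Notation C := R[i].

Lemma entire_bounded_square (f : C -> C) (x0 y0 : R) : entire f ->
  exists M : R, forall x y, `|x - x0| <= 1 -> `|y - y0| <= 1 -> nc (f (x +i* y)%C) <= M.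
Proof.
move=> ef; apply: contrapT => unb.
pose Bad (a b c d : R) := forall M, exists x y, [/\ a <= x <= b, c <= y <= d &
  M < nc (f (x +i* y)%C)].
have [||||x [y [_ _ H]]] := @bisection R Bad (x0 - 1) (x0 + 1) (y0 - 1) (y0 + 1).
- by lra.
- by lra.
- move=> a b c d ab cd bad; apply: contrapT => nb.
  have bnd a' b' c' d' : ~ Bad a' b' c' d' -> exists M, forall x y,
      a' <= x <= b' -> c' <= y <= d' -> nc (f (x +i* y)%C) <= M.
    move=> /existsNP[M nM]; exists M => x y xab ycd.
    by rewrite leNgt; apply/negP => lt; apply: nM; exists x, y.
  have [|M1 H1] := bnd a ((a + b) / 2) c ((c + d) / 2).
    by move=> B; apply: nb; constructor 1.
  have [|M2 H2] := bnd ((a + b) / 2) b c ((c + d) / 2).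
    by move=> B; apply: nb; constructor 2.
  have [|M3 H3] := bnd a ((a + b) / 2) ((c + d) / 2) d.
    by move=> B; apply: nb; constructor 3.
  have [|M4 H4] := bnd ((a + b) / 2) b ((c + d) / 2) d.
    by move=> B; apply: nb; constructor 4.
  have [x [y [/andP[ax xb] /andP[cy yd]]]] := bad (Num.max (Num.max M1 M2) (Num.max M3 M4)).
  rewrite !gt_max => /andP[/andP[m1 m2] /andP[m3 m4]].
  case: (leP x ((a + b) / 2)) => xm; case: (leP y ((c + d) / 2)) => ym.
  + by have := H1 x y; rewrite ax xm cy ym leNgt m1 => /(_ isT isT).
  + by have := H3 x y; rewrite ax xm (ltW ym) yd leNgt m3 => /(_ isT isT).
  + by have := H2 x y; rewrite xb (ltW xm) cy ym leNgt m2 => /(_ isT isT).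
  + by have := H4 x y; rewrite xb (ltW xm) (ltW ym) yd leNgt m4 => /(_ isT isT).
- move=> M; apply: contrapT => nM; apply: unb; exists M => x y.
  rewrite !ler_norml => xx yy; rewrite leNgt; apply/negP => lt; apply: nM.
  by exists x, y; split => //; lra.
have [d d0 D] := entire_normc_cont ef (x +i* y)%C ltr01.
have d20 : 0 < d / 2 by rewrite divr_gt0.
have [a [b [c [e [/andP[? ?] /andP[? ?] ba ec bad]]]]] := H _ d20.
have [s [t [/andP[? ?] /andP[? ?]]]] := bad (nc (f (x +i* y)%C) + 1).
have : `|nc (f (s +i* t)%C) - nc (f (x +i* y)%C)| <= 1.
  apply: D; rewrite (le_lt_trans (normc_le_ReIm _))//=.
  have h1 : `|s - x| < d / 2 by rewrite ltr_norml; lra.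
  have h2 : `|t - y| < d / 2 by rewrite ltr_norml; lra.
  by lra.
by rewrite ler_norml; lra.
Qed.

(** For p < 1 this is t = t^(1 - p) t^p; for p >= 1 it is t <= 1 + t^p. *)
Lemma powR_interpolation (p t T : R) : 0 < p -> 0 <= t <= T ->
  t <= T `^ (1 - Num.min 1 p) * (1 + t `^ p).
Proof.
move=> p0 /andP[t0 tT]; have [p1|p1] := leP 1 p.
  rewrite subrr powRr0 mul1r; have [t1|t1] := leP t 1.
    by rewrite (le_trans t1)// lerDl powR_ge0.
  by rewrite (le_trans (le1r_powR (ltW t1) p1))// lerDr.
have [->|tn0] := eqVneq t 0; first by rewrite mulr_ge0 ?addr_ge0 ?powR_ge0.
rewrite -{1}(powRr1 t0) -{1}(subrK p 1) powRD; last by rewrite tn0 implybT.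
apply: ler_pM; rewrite ?powR_ge0 ?lerDr//.
by apply: le_powR; rewrite ?subr_ge0 ?(ltW p1).
Qed.

(** For p < 1 the function |g| is bounded by T^(1 - p) (1 + |g|^p) only where |g| <= T, and the
supremum of |g| on the square of radius r may be much larger than its value at the center. Let N
be the supremum of |g| d^(2 / p), where d is the distance to the boundary of the unit square. Near
a point where N is almost attained, with r half its distance to the boundary, |g| is at most
T = N / r^(2 / p), which is comparable to its value there; the mean value inequality on the square
of radius r then bounds N^p. *)
Lemma local_bound (p K : R) : 0 < p -> 0 <= K -> exists2 B : R, 0 <= B &
  forall (g : C -> C) (G : R * R -> R) (x0 y0 : R), entire g ->
    measurable_fun setT G -> (forall xy, 0 <= G xy) ->
    (\int[(mu \x mu)%E]_xy (G xy)%:E <= K%:E)%E ->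
    (forall x y, `|x - x0| <= 1 -> `|y - y0| <= 1 ->
       nc (g (x +i* y)%C) `^ p <= G (x, y)) ->
    nc (g (x0 +i* y0)%C) <= B.
Proof.
move=> p0 K0; pose p' := Num.min 1 p; pose k : R := 2 / p'.
have p'0 : 0 < p' by rewrite lt_min ltr01.
have k0 : 0 < k by rewrite divr_gt0.
have kn0 : k != 0 by rewrite gt_eqF.
have kp : k * p' = 2 by rewrite /k divfK// gt_eqF.
pose B0 := 2 * 2 `^ k * (64 * (K + 2)).
have B00 : 0 <= B0 by rewrite !mulr_ge0 ?powR_ge0// addr_ge0.
exists (B0 `^ p'^-1); first exact: powR_ge0.
move=> g G x0 y0 eg mG G0 GK H.
pose d x y : R := 1 - Num.max `|x - x0| `|y - y0|.
pose A := [set v : R | exists x y, [/\ `|x - x0| <= 1, `|y - y0| <= 1 &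
  v = nc (g (x +i* y)%C) * d x y `^ k]].
have d1 x y : d x y <= 1 by rewrite lerBlDr lerDl le_max normr_ge0.
have d_ge0 x y : `|x - x0| <= 1 -> `|y - y0| <= 1 -> 0 <= d x y.
  by move=> hx hy; rewrite subr_ge0 ge_max hx.
have [M HM] := @entire_bounded_square g x0 y0 eg.
have pow1 x y : `|x - x0| <= 1 -> `|y - y0| <= 1 -> d x y `^ k <= 1.
  move=> hx hy; have := le_powR (ltW k0) (d_ge0 x y hx hy) (d1 x y).
  by rewrite powR1.
have supA : has_sup A.
  split; first by exists (nc (g (x0 +i* y0)%C) * d x0 y0 `^ k), x0, y0; rewrite !subrr normr0 ler01.
  exists M => _ [x [y [hx hy ->]]]; rewrite (le_trans _ (HM x y hx hy))//.
  by rewrite ler_piMr ?normc_ge0// pow1.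
pose N := sup A.
have Nub x y : `|x - x0| <= 1 -> `|y - y0| <= 1 -> nc (g (x +i* y)%C) * d x y `^ k <= N.
  by move=> hx hy; apply: ub_le_sup; [exact: supA.2|exists x, y].
have center : nc (g (x0 +i* y0)%C) <= N.
  have := Nub x0 y0; rewrite /d !subrr normr0 maxxx subr0 powR1 mulr1.
  by apply; exact: ler01.
apply: (le_trans center).
have [N0|N0] := leP N 0; first by rewrite (le_trans N0)// powR_ge0.
have N20 : 0 < N / 2 by rewrite divr_gt0.
have [_ [x1 [y1 [hx hy ->]]] big] := sup_adherent N20 supA.
have {}big : N / 2 < nc (g (x1 +i* y1)%C) * d x1 y1 `^ k.
  by rewrite (le_lt_trans _ big)// -/N; lra.
have dn0 : 0 < d x1 y1.
  rewrite lt_neqAle d_ge0// andbT; apply/eqP => d0.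
  by move: big; rewrite -d0 powR0// mulr0 ltNge divr_ge0// ltW.
pose r := d x1 y1 / 2; have r0 : 0 < r by rewrite divr_gt0.
have r1 : r <= 1 by have := d1 x1 y1; rewrite /r; lra.
have rk0 : 0 < r `^ k by rewrite powR_gt0.
pose T := N / r `^ k.
have T0 : 0 < T by rewrite divr_gt0.
have near x y : `|x - x1| <= r -> `|y - y1| <= r ->
    [/\ `|x - x0| <= 1, `|y - y0| <= 1 & r <= d x y].
  move=> xr yr; have xx := ler_normD (x - x1) (x1 - x0).
  have yy := ler_normD (y - y1) (y1 - y0).
  rewrite !addrA !subrK in xx yy.
  have : d x1 y1 = 2 * r by rewrite /r; field.
  rewrite /d => dE.
  have mx : `|x1 - x0| <= Num.max `|x1 - x0| `|y1 - y0| by rewrite le_max lexx.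
  have my : `|y1 - y0| <= Num.max `|x1 - x0| `|y1 - y0| by rewrite le_max lexx orbT.
  split; [lra|lra|].
  by rewrite lerBrDr -lerBrDl ge_max; apply/andP; split; lra.
have gT x y : `|x - x1| <= r -> `|y - y1| <= r -> nc (g (x +i* y)%C) <= T.
  move=> /near h /h[hx' hy' rd]; rewrite ler_pdivlMr//.
  rewrite (le_trans _ (Nub x y hx' hy'))// ler_wpM2l ?normc_ge0//.
  by apply: le_powR => //; exact: ltW.
have S0 : 0 <= T `^ (1 - p') by exact: powR_ge0.
have := @submean_area R G K mG G0 K0 GK g x1 y1 r _ eg r0 S0.
have hyp x y : `|x - x1| <= r -> `|y - y1| <= r ->
    nc (g (x +i* y)%C) <= T `^ (1 - p') * (1 + G (x, y)).
  move=> hx' hy'; have [hx0 hy0 _] := near x y hx' hy'.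
  apply: (le_trans (@powR_interpolation p _ T p0 _)); first by rewrite normc_ge0 gT.
  by rewrite ler_wpM2l// lerD2l H.
move=> /(_ hyp) le.
have r2 : r `^ k `^ p' = r ^+ 2 by rewrite -powRrM kp powR_mulrn// ltW.
have TE : T `^ (1 - p') = T / T `^ p'.
  by rewrite powRB ?powRr1 ?(ltW T0)//; rewrite (gt_eqF T0) implybT.
have Tp : T `^ p' = N `^ p' / r ^+ 2.
  rewrite -r2 /T powRM ?(ltW N0) ?invr_ge0 ?(ltW rk0)//; congr (_ * _).
  by rewrite -(powR_inv1 (ltW rk0)) powRAC powR_inv1 ?powR_ge0.
have Np0 : 0 < N `^ p' by rewrite powR_gt0.
have big' : T / (2 * 2 `^ k) < nc (g (x1 +i* y1)%C).
  rewrite ltr_pdivrMr ?mulr_gt0 ?powR_gt0// /T ltr_pdivrMr//.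
  move: big; rewrite (_ : d x1 y1 = 2 * r); last by rewrite /r; field.
  rewrite powRM ?(ltW r0)//; lra.
have le2 : T / (2 * 2 `^ k) <= 64 * (K + 2) * (T / N `^ p').
  rewrite (le_trans (ltW big'))// (le_trans le)// TE Tp.
  rewrite (_ : _ * (1 + _) = 64 * (T / N `^ p') * (r ^+ 2 + (K + 1))); last first.
    by field; rewrite !gt_eqF.
  have X0 : 0 <= T / N `^ p' by rewrite divr_ge0// ltW.
  have r2le : 0 <= 1 - r ^+ 2 by rewrite subr_ge0 expr_le1// ltW.
  have := mulr_ge0 X0 r2le; lra.
have le3 : N `^ p' <= B0.
  move: le2; rewrite ler_pdivrMr ?mulr_gt0 ?powR_gt0//.
  rewrite (_ : 64 * (K + 2) * (T / N `^ p') * (2 * 2 `^ k) = T * (B0 / N `^ p')); last by rewrite /B0; field; rewrite gt_eqF.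
  by rewrite ler_pMr// ler_pdivlMr// mul1r.
rewrite -[leLHS](powRr1 (ltW N0)) -(divff (lt0r_neq0 p'0)) powRrM.
by apply: le_powR; rewrite ?invr_ge0 ?powR_ge0 ?(ltW p'0).
Qed.

End local_bound.

(** * Gaussian integrals *)

Section gaussians.
Context {R : realType}.

Lemma integral_gauss_line (A m : R) : 0 < A ->
  (\int[mu]_x (expR (- (A * (x - m) ^+ 2)))%:E = (Num.sqrt (pi / A))%:E)%E.
Proof.
move=> A0; pose s := Num.sqrt ((2 * A)^-1).
have s2 : s ^+ 2 = (2 * A)^-1 by rewrite sqr_sqrtr// invr_ge0 mulr_ge0// ltW.
have s0 : s != 0 by rewrite gt_eqF// sqrtr_gt0 invr_gt0 mulr_gt0.
have pk : normal_peak s = (Num.sqrt (pi / A))^-1.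
  by rewrite /normal_peak s2; congr (Num.sqrt _)^-1; field; rewrite gt_eqF.
have pk0 : 0 < normal_peak s by exact: normal_peak_gt0.
have := integral_normal_pdf m s.
under eq_integral => x _.
  rewrite normal_pdfE// EFinM (_ : normal_fun m s x = expR (- (A * (x - m) ^+ 2))); last first.
    by rewrite /normal_fun s2; congr expR; field; rewrite gt_eqF.
  over.
rewrite ge0_integralZl_EFin ?(ltW pk0)//; first last.
- apply/measurable_EFinP; apply: measurableT_comp => //.
  apply: measurableT_comp => //; apply: measurable_funM => //.
  by apply: measurable_funX; exact: measurable_funB.
move=> /(congr1 (fun t => (Num.sqrt (pi / A))%:E * t)%E) /=.
rewrite muleA -EFinM pk mulfV ?mul1e ?mule1//.
by rewrite gt_eqF// sqrtr_gt0 divr_gt0// pi_gt0.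
Qed.

Lemma gauss_plane_measurable (A B n : R) (m : R -> R) : measurable_fun setT m ->
  measurable_fun setT (fun xy : R * R =>
    expR (- (A * (xy.1 - m xy.2) ^+ 2 + B * (xy.2 - n) ^+ 2))).
Proof.
move=> mm; have m1 : measurable_fun setT (fun xy : R * R => xy.1) by exact: measurable_fst.
have m2 : measurable_fun setT (fun xy : R * R => xy.2) by exact: measurable_snd.
apply: measurableT_comp => //; apply: measurableT_comp => //.
apply: measurable_funD; apply: measurable_funM => //; apply: measurable_funX.
  apply: measurable_funB => //; exact: (measurableT_comp mm).
exact: measurable_funB.
Qed.

(** The center m y of the inner Gaussian depends on y, which covers quadratic forms with a cross
term after completion of the square. *)
Lemma integral_gauss_plane (A B n : R) (m : R -> R) : 0 < A -> 0 < B ->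
  measurable_fun setT m ->
  (\int[(mu \x mu)%E]_xy
     (expR (- (A * (xy.1 - m xy.2) ^+ 2 + B * (xy.2 - n) ^+ 2)))%:E =
   (Num.sqrt (pi / A) * Num.sqrt (pi / B))%:E)%E.
Proof.
move=> A0 B0 mm.
rewrite (fubini_tonelli2 (m2 := mu)); first last.
- by move=> xy; rewrite lee_fin expR_ge0.
- by apply/measurable_EFinP; exact: gauss_plane_measurable.
rewrite /fubini_G /=.
transitivity (\int[mu]_y ((Num.sqrt (pi / A))%:E * (expR (- (B * (y - n) ^+ 2)))%:E))%E.
  apply: eq_integral => y _; rewrite -(integral_gauss_line (m y) A0).
  under eq_integral do rewrite opprD expRD mulrC EFinM.
  rewrite ge0_integralZl_EFin ?expR_ge0//; first by rewrite muleC.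
  apply/measurable_EFinP; apply: measurableT_comp => //.
  apply: measurableT_comp => //; apply: measurable_funM => //.
  by apply: measurable_funX; exact: measurable_funB.
rewrite ge0_integralZl_EFin ?sqrtr_ge0//; first by rewrite integral_gauss_line.
apply/measurable_EFinP; apply: measurableT_comp => //.
apply: measurableT_comp => //; apply: measurable_funM => //.
by apply: measurable_funX; exact: measurable_funB.
Qed.

End gaussians.

(** * Growth and Lipschitz bounds in Fock spaces *)

Section fock_estimates.
Context {R : realType}.
Local Notation C := R[i].
Implicit Types (f h : C -> C) (p q : R).

Definition fock_density p f (xy : R * R) : R :=
  nc (f (complex_of_pair xy)) `^ p * expR (- (p * nc (complex_of_pair xy) ^+ 2 / 2)).

Lemma fock_density_ge0 p f xy : 0 <= fock_density p f xy.
Proof. by rewrite mulr_ge0 ?powR_ge0 ?expR_ge0. Qed.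

Lemma fock_density_measurable p f : entire f -> measurable_fun setT (fock_density p f).
Proof.
move=> ef; apply: measurable_funM.
  exact: (measurableT_comp (measurable_powR p) (entire_normc_measurable ef)).
apply: measurableT_comp => //; apply: measurableT_comp => //.
apply: measurable_funM => //; apply: measurable_funM => //; apply: measurable_funX.
exact: (entire_normc_measurable (@entire_id R)).
Qed.

Lemma fock_norm_le p f (M : R) : 0 < p -> 0 <= M ->
  (fock_norm p f <= M%:E)%E <->
  (\int[(mu \x mu)%E]_xy (fock_density p f xy)%:E <= (M `^ p * (2 * pi / p))%:E)%E.
Proof.
move=> p0 M0; rewrite /fock_norm -/(fock_density p f).
set I := (\int[_]_xy _)%E.
have I0 : (0 <= I)%E by apply: integral_ge0 => xy _; rewrite lee_fin fock_density_ge0.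
have c0 : 0 < p / (2 * pi) by rewrite divr_gt0// mulr_gt0// pi_gt0.
have pn0 : p != 0 by rewrite gt_eqF.
have pi0 : pi != 0 :> R by rewrite gt_eqF// pi_gt0.
have -> : (I <= (M `^ p * (2 * pi / p))%:E)%E = ((p / (2 * pi))%:E * I <= (M `^ p)%:E)%E.
  rewrite -(@lee_pmul2l _ (p / (2 * pi))%:E) ?lte_fin// -EFinM.
  by congr (_ <= _%:E)%E; move: pi0; move: (pi : R) => P P0; field; rewrite pn0.
have cI0 : (0 <= (p / (2 * pi))%:E * I)%E by rewrite mule_ge0// lee_fin ltW.
have mono (r : R) (x y : \bar R) : 0 <= r -> (0 <= x)%E -> (x <= y)%E -> (x `^ r <= y `^ r)%E.
  move=> r0 x0 xy; apply: gt0_ler_poweR => //; rewrite in_itv/= leey andbT//.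
  exact: le_trans xy.
split=> H.
  have := mono p _ _ (ltW p0) (poweR_ge0 _ _) H.
  by rewrite -poweRrM mulVf// poweRe1// poweR_EFin.
have pi_ge : 0 <= p^-1 by rewrite invr_ge0 ltW.
have := mono p^-1 _ _ pi_ge cI0 H.
by rewrite poweR_EFin -powRrM mulfV// powRr1.
Qed.

(** [local_bound] for f divided by la = e^((|w| + 2)^2 / 2): on the unit square around w one has
|z| <= |w| + 2, so that la^(-p) is at most the weight of F^p. *)
Lemma fock_pointwise p (M : R) : 0 < p -> 0 <= M -> exists2 B : R, 0 <= B &
  forall f, entire f -> (fock_norm p f <= M%:E)%E ->
    forall w, nc (f w) <= B * expR ((nc w + 2) ^+ 2 / 2).
Proof.
move=> p0 M0; pose K := M `^ p * (2 * pi / p).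
have K0 : 0 <= K by rewrite mulr_ge0 ?powR_ge0// divr_ge0 ?(ltW p0)// mulr_ge0// pi_ge0.
have [B B0 HB] := local_bound p0 K0; exists B => // f ef /(fock_norm_le _ p0 M0) fM.
move=> [x0 y0]; set w := (x0 +i* y0)%C.
set la := expR _; have la0 : 0 < la by exact: expR_gt0.
rewrite -ler_pdivrMr//.
have eg := entireM (@entire_cst R (la^-1)%:C%C) ef.
have ng z : nc ((la^-1)%:C%C * f z) = la^-1 * nc (f z).
  by rewrite normcM /= expr0n addr0 sqrtr_sqr ger0_norm// invr_ge0 ltW.
have := HB _ _ x0 y0 eg (fock_density_measurable p ef) (fock_density_ge0 p f) fM.
rewrite ng mulrC; apply => x y hx hy; rewrite ng powRM ?invr_ge0 ?(ltW la0) ?normc_ge0//.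
rewrite /fock_density mulrC ler_wpM2l ?powR_ge0//.
rewrite -expRN -expRM ler_expR.
have wn : 0 <= nc w by exact: normc_ge0.
have zn : nc (complex_of_pair (x, y)) <= nc w + 2.
  rewrite (_ : complex_of_pair (x, y) = w + ((x - x0) +i* (y - y0))%C).
    rewrite (le_trans (le_normcD _ _))// lerD2l (le_trans (normc_le_ReIm _))//=; lra.
  by apply/eqP; rewrite eq_complex/=; apply/andP; split; apply/eqP; ring.
have : nc (complex_of_pair (x, y)) ^+ 2 <= (nc w + 2) ^+ 2.
  by rewrite lerXn2r ?nnegrE ?normc_ge0// addr_ge0.
by move=> h; rewrite mulNr lerN2 [_ * p]mulrC -mulrA ler_pM2l// ler_pM2r.
Qed.

Lemma fock_lipschitz p (M : R) : 0 < p -> 0 <= M -> exists2 B : R, 0 <= B &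
  forall f, entire f -> (fock_norm p f <= M%:E)%E ->
    forall (rho : R) w z, nc w <= rho -> nc z <= rho ->
      nc (f z - f w) <= B * expR ((rho + 4) ^+ 2 / 2) * nc (z - w).
Proof.
move=> p0 M0; have [B B0 HB] := fock_pointwise p0 M0.
exists (64 * B); first by rewrite mulr_ge0.
move=> f ef fM rho w z wr zr; apply: mean_value_ineq => t /andP[t0 t1].
have [l fl] := entireP ef (w + t%:C%C * (z - w)); exists l => //.
set u := w + _ in fl.
have ur : nc u <= rho.
  have -> : u = (1 - t)%:C%C * w + t%:C%C * z by rewrite /u rmorphB rmorph1/=; ring.
  rewrite (le_trans (le_normcD _ _))// !normcM.
  have nR (s : R) : 0 <= s -> nc s%:C%C = s.
    by move=> s0; rewrite /= expr0n addr0 sqrtr_sqr ger0_norm.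
  have t1' : 0 <= 1 - t by rewrite subr_ge0.
  rewrite !nR//.
  have := ler_wpM2l t1' wr; have := ler_wpM2l t0 zr; lra.
have rho0 : 0 <= rho := le_trans (normc_ge0 w) wr.
rewrite -[leRHS]divr1 -(mulrA 64).
apply: (@cderiv_bound _ f (Re u) (Im u)) => //; last by rewrite -(_ : u = (_ +i* _)%C)//; case: (u).
move=> x y hx hy; rewrite (le_trans (HB f ef fM _))// ler_wpM2l// ler_expR ler_pM2r//.
rewrite lerXn2r ?nnegrE ?addr_ge0 ?normc_ge0//.
rewrite (_ : (x +i* y)%C = u + ((x - Re u) +i* (y - Im u))%C).
  have := le_normcD u ((x - Re u) +i* (y - Im u))%C.
  have := normc_le_ReIm ((x - Re u) +i* (y - Im u))%C; rewrite /=; lra.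
by apply/eqP; rewrite eq_complex; case: (u) => ? ? /=; apply/andP; split; apply/eqP; ring.
Qed.

(** Since rho < 1, the exponent t + (rho t + B)^2 / 2 - t^2 / 2 is at most M0 - ka t^2 with
ka > 0, so that the density of h is dominated by an integrable Gaussian. *)
Lemma gauss_dominated q (rho B : R) : 0 < q -> 0 <= rho < 1 -> 0 <= B ->
  exists2 K : R, 0 <= K & forall h (S : R), entire h -> 0 <= S ->
    (forall z, nc (h z) <= S * expR (nc z + (rho * nc z + B) ^+ 2 / 2)) ->
    (fock_norm q h <= (S * K)%:E)%E.
Proof.
move=> q0 /andP[rho0 rho1] B0.
pose ka := (1 - rho ^+ 2) / 4; pose be := 1 + rho * B.
have ka0 : 0 < ka.
  by rewrite divr_gt0// subr_gt0 expr_lt1.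
pose M0 := B ^+ 2 / 2 + be ^+ 2 / (4 * ka).
have expo (t : R) : t + (rho * t + B) ^+ 2 / 2 - t ^+ 2 / 2 <= M0 - ka * t ^+ 2.
  rewrite -subr_ge0 (_ : _ - _ = ka * (t - be / (2 * ka)) ^+ 2).
    by rewrite mulr_ge0 ?sqr_ge0// ltW.
  have rE : rho ^+ 2 = 1 - 4 * ka by rewrite /ka; field.
  rewrite (_ : (rho * t + B) ^+ 2 = rho ^+ 2 * t ^+ 2 + 2 * rho * B * t + B ^+ 2); last by ring.
  rewrite rE /M0 /be; move: ka0; clear; move: ka => k k0; field; rewrite gt_eqF//.
pose Ga := Num.sqrt (pi / (q * ka)) * Num.sqrt (pi / (q * ka)).
have Ga0 : 0 <= Ga by rewrite mulr_ge0 ?sqrtr_ge0.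
pose L := expR (q * M0) * Ga.
have L0 : 0 <= L by rewrite mulr_ge0 ?expR_ge0.
have c0 : 0 < 2 * pi / q by rewrite divr_gt0// mulr_gt0// pi_gt0.
pose K := (L / (2 * pi / q)) `^ q^-1.
have K0 : 0 <= K by exact: powR_ge0.
have KE : K `^ q * (2 * pi / q) = L.
  rewrite -powRrM mulVf ?gt_eqF// powRr1; last by rewrite divr_ge0// ltW.
  by rewrite divfK// gt_eqF.
exists K => // h S eh S0 H; apply/(fock_norm_le _ q0 (mulr_ge0 S0 K0)).
rewrite powRM// -mulrA KE /L.
have mg : measurable_fun setT (fun xy : R * R =>
    expR (- (q * ka * (xy.1 - 0) ^+ 2 + q * ka * (xy.2 - 0) ^+ 2))).
  exact: (@gauss_plane_measurable _ _ _ _ (fun=> 0)).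
apply: (@le_trans _ _ (\int[(mu \x mu)%E]_xy ((S `^ q * expR (q * M0))%:E *
    (expR (- (q * ka * (xy.1 - 0) ^+ 2 + q * ka * (xy.2 - 0) ^+ 2)))%:E))%E).
  apply: ge0_le_integral => //.
  - by move=> xy _; rewrite lee_fin fock_density_ge0.
  - by apply/measurable_EFinP; exact: fock_density_measurable.
  - by apply/measurable_EFinP; exact: measurable_funM.
  move=> xy _; rewrite -EFinM lee_fin /fock_density.
  set z := complex_of_pair xy.
  have zE : xy.1 ^+ 2 + xy.2 ^+ 2 = nc z ^+ 2 by rewrite normc_sqr.
  apply: (@le_trans _ _ (S `^ q * expR (q * (nc z + (rho * nc z + B) ^+ 2 / 2)) *
      expR (- (q * nc z ^+ 2 / 2)))).
    rewrite ler_wpM2r ?expR_ge0// [q * (_ + _)]mulrC expRM -powRM ?expR_ge0//.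
    by apply: le_powR; rewrite ?normc_ge0// ltW.
  rewrite -[leLHS]mulrA -expRD -[leRHS]mulrA -expRD ler_wpM2l ?powR_ge0// ler_expR !subr0.
  rewrite -(mulrDr (q * ka)) zE.
  rewrite (_ : q * _ - _ = q * (nc z + (rho * nc z + B) ^+ 2 / 2 - nc z ^+ 2 / 2)); last by ring.
  rewrite (_ : q * M0 + _ = q * (M0 - ka * nc z ^+ 2)); last by ring.
  by rewrite ler_pM2l.
rewrite ge0_integralZl_EFin//; first last.
- by rewrite mulr_ge0 ?powR_ge0 ?expR_ge0.
- exact/measurable_EFinP.
have qk0 : 0 < q * ka by rewrite mulr_gt0.
have m0 : measurable_fun setT (fun _ : R => 0 : R) by exact: measurable_cst.
have GE := @integral_gauss_plane R _ _ 0 (fun=> 0) qk0 qk0 m0.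
by rewrite GE -EFinM mulrA.
Qed.

End fock_estimates.

(** * Composition with affine maps *)

Section affine_composition.
Context {R : realType}.
Local Notation C := R[i].

Definition affine (a b : C) : C -> C := fun z => a * z + b.

Lemma entire_affine a b : entire (affine a b).
Proof. exact: (entireD (entireM (@entire_cst R a) (@entire_id R)) (@entire_cst R b)). Qed.

Lemma normc_affine_le (a b z : C) (rho B : R) : nc a <= rho -> nc b <= B ->
  nc (affine a b z) <= rho * nc z + B.
Proof.
move=> ar bB; rewrite (le_trans (le_normcD _ _))// lerD// normcM.
by rewrite ler_wpM2r ?normc_ge0.
Qed.

Lemma affine_comp_bound (p q : R) (rho B M : R) : 0 < p -> 0 < q ->
  0 <= rho < 1 -> 0 <= B -> 0 <= M -> exists2 K : R, 0 <= K &
  forall f a b, entire f -> (fock_norm p f <= M%:E)%E -> nc a <= rho -> nc b <= B ->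
    (fock_norm q (f \o affine a b) <= K%:E)%E.
Proof.
move=> p0 q0 rho01 B0 M0; have /andP[rho0 _] := rho01.
have [A A0 HA] := fock_pointwise p0 M0.
have [|K K0 HK] := @gauss_dominated R q rho (B + 2) q0 rho01; first by rewrite addr_ge0.
exists (A * K); first by rewrite mulr_ge0.
move=> f a b ef fM ar bB; apply: (HK _ _ (entire_comp ef (@entire_affine a b)) A0).
move=> z; rewrite (le_trans (HA f ef fM _))// ler_wpM2l// ler_expR.
rewrite ler_wpDl ?normc_ge0// ler_pM2r// lerXn2r ?nnegrE ?addr_ge0 ?mulr_ge0 ?normc_ge0//.
by have := normc_affine_le z ar bB; lra.
Qed.

Lemma affine_comp_lipschitz (p q : R) (rho B M : R) : 0 < p -> 0 < q ->
  0 <= rho < 1 -> 0 <= B -> 0 <= M -> exists2 K : R, 0 <= K &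
  forall f a b a' b', entire f -> (fock_norm p f <= M%:E)%E ->
    nc a <= rho -> nc b <= B -> nc a' <= rho -> nc b' <= B ->
    (fock_norm q ((f \o affine a b) \- (f \o affine a' b'))%R <=
       ((nc (a - a') + nc (b - b')) * K)%:E)%E.
Proof.
move=> p0 q0 rho01 B0 M0; have /andP[rho0 _] := rho01.
have [A A0 HA] := fock_lipschitz p0 M0.
have [|K K0 HK] := @gauss_dominated R q rho (B + 4) q0 rho01; first by rewrite addr_ge0.
exists (A * K); first by rewrite mulr_ge0.
move=> f a b a' b' ef fM ar bB ar' bB'; rewrite mulrA.
have eh : entire ((f \o affine a b) \- (f \o affine a' b')).
  have e1 := entire_comp ef (@entire_affine a b).
  have e2 := entireM (@entire_cst R (-1)) (entire_comp ef (@entire_affine a' b')).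
  have := entireD e1 e2; congr entire; apply/funext => z /=.
  by rewrite mulN1r.
have S0 : 0 <= (nc (a - a') + nc (b - b')) * A.
  by rewrite mulr_ge0// addr_ge0 ?normc_ge0.
apply: (HK _ _ eh S0) => z; have w1 := normc_affine_le z ar bB; have w2 := normc_affine_le z ar' bB'.
rewrite /= (le_trans (HA f ef fM _ _ _ w2 w1))//.
have dle : nc (affine a b z - affine a' b' z) <= (nc (a - a') + nc (b - b')) * expR (nc z).
  rewrite (_ : _ - _ = (a - a') * z + (b - b')); last by rewrite /affine; ring.
  rewrite (le_trans (le_normcD _ _))// normcM mulrDl.
  have e1 : 1 + nc z <= expR (nc z) by exact: expR_ge1Dx.
  have z0 := normc_ge0 z.
  rewrite lerD//; first by rewrite ler_wpM2l ?normc_ge0//; lra.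
  by rewrite ler_peMr ?normc_ge0//; lra.
rewrite (le_trans (ler_wpM2l _ dle)) ?mulr_ge0 ?expR_ge0//.
rewrite (_ : rho * nc z + (B + 4) = rho * nc z + B + 4); last by ring.
rewrite expRD le_eqVlt; apply/orP; left; apply/eqP; ring.
Qed.

End affine_composition.

Section composition_space.
Context {R : realType}.
Local Notation C := R[i].
Context (p q : R) (p0 : 0 < p) (q0 : 0 < q).

Lemma affine_comp_bounded (a b : C) : nc a < 1 ->
  @bounded_composition_ops R p q (@composition_op R p (affine a b)).
Proof.
move=> a1; split; first by exists (affine a b) => //; exact: entire_affine.
have rho01 : 0 <= nc a < 1 by rewrite normc_ge0.
split.
  move=> f; have [ef fN] : fock p (set_val f) := set_valP f.
  split; first exact: (entire_comp ef (@entire_affine R a b)).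
  have fN0 : (0 <= fock_norm p (set_val f))%E by exact: poweR_ge0.
  have fin : fock_norm p (set_val f) \is a fin_num by rewrite ge0_fin_numE.
  have M0 : 0 <= fine (fock_norm p (set_val f)) by exact: fine_ge0.
  have [K _ HK] := affine_comp_bound p0 q0 rho01 (normc_ge0 b) M0.
  apply: le_lt_trans (HK (set_val f) a b ef _ (lexx _) (lexx _)) (ltry _).
  by rewrite fineK.
have [K _ HK] := affine_comp_bound p0 q0 rho01 (normc_ge0 b) ler01.
apply: (@le_lt_trans _ _ K%:E); last exact: ltry.
apply: ge_ereal_sup => _ [f /= fN <-].
by have [ef _] : fock p (set_val f) := set_valP f; exact: HK.
Qed.

(** The path is given by the straight segment between the parameters (a, b) and (a', b'), along
which |a| and |b| stay below the maxima rho < 1 and B of their values at the ends. *)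
Lemma affine_path_connected (a b a' b' : C) (S T : comp_space R p q) :
  nc a < 1 -> nc a' < 1 ->
  set_val S = @composition_op R p (affine a b) ->
  set_val T = @composition_op R p (affine a' b') ->
  exists g : R -> comp_space R p q,
    [/\ {within `[0, 1], continuous g}, g 0 = S & g 1 = T].
Proof.
move=> a1 a1' SE TE.
(* the path is extended to the whole line by clamping the time to [0, 1] *)
pose cl (t : R) := Num.max 0 (Num.min 1 t).
have cl01 t : 0 <= cl t <= 1.
  by rewrite /cl le_max lexx/= ge_max ler01 ge_min lexx.
have clE t : 0 <= t <= 1 -> cl t = t.
  by move=> /andP[t0 t1]; rewrite /cl (min_idPr t1) (max_idPr t0).
have cl_lip s t : `|cl s - cl t| <= `|s - t|.
  have h1 := ler_norm (s - t); have h2 := ler_norm (t - s); rewrite distrC in h2.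
  by rewrite /cl; case: (leP 1 s) => ?; case: (leP 1 t) => ?; rewrite ?maxEle;
     do ?case: ifPn => [?|]; rewrite -?ltNge => *; rewrite ler_norml; lra.
pose la t : C := (1 - t)%:C%C * a + t%:C%C * a'.
pose lb t : C := (1 - t)%:C%C * b + t%:C%C * b'.
pose rho := Num.max (nc a) (nc a'); pose B := Num.max (nc b) (nc b').
have nR (s : R) : nc s%:C%C = `|s| by rewrite /= expr0n addr0 sqrtr_sqr.
have conv (u v : C) t : 0 <= t <= 1 ->
    nc ((1 - t)%:C%C * u + t%:C%C * v) <= Num.max (nc u) (nc v).
  move=> /andP[t0 t1]; rewrite (le_trans (le_normcD _ _))// !normcM !nR.
  rewrite !ger0_norm ?subr_ge0//.
  have u1 : nc u <= Num.max (nc u) (nc v) by rewrite le_max lexx.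
  have v1 : nc v <= Num.max (nc u) (nc v) by rewrite le_max lexx orbT.
  have t1' : 0 <= 1 - t by rewrite subr_ge0.
  have := ler_wpM2l t1' u1; have := ler_wpM2l t0 v1; lra.
have rho01 : 0 <= rho < 1 by rewrite le_max normc_ge0/= gt_max a1.
have B0 : 0 <= B by rewrite le_max normc_ge0.
have bnd t : nc (la (cl t)) < 1.
  by apply: le_lt_trans (conv _ _ _ (cl01 t)) _; case/andP: rho01.
pose g (t : R) : comp_space R p q :=
  SigSub (mem_set (affine_comp_bounded (lb (cl t)) (bnd t))).
exists g; split; last 2 first.
- apply: val_inj => /=; rewrite -[RHS]/(set_val S) SE clE ?lexx ?ler01//.
  by rewrite /la /lb subr0 rmorph1 rmorph0 !mul1r !mul0r !addr0.
- apply: val_inj => /=; rewrite -[RHS]/(set_val T) TE clE ?lexx ?ler01//.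
  by rewrite /la /lb subrr rmorph1 rmorph0 !mul1r !mul0r !add0r.
have [K K0 HK] := affine_comp_lipschitz p0 q0 rho01 B0 ler01.
pose L := nc (a' - a) + nc (b' - b).
have L0 : 0 <= L by rewrite addr_ge0 ?normc_ge0.
have dist s t : (comp_space_dist (g s) (g t) <= (((`|s - t| * L) * K) `^ Num.min 1 q)%:E)%E.
  rewrite /comp_space_dist -poweR_EFin.
  have m0 : 0 <= Num.min 1 q by rewrite le_min ler01 ltW.
  set N := op_norm _ _.
  have NK : (N <= ((`|s - t| * L) * K)%:E)%E.
    apply: ge_ereal_sup => _ [f /= fN <-].
    have [ef _] : fock p (set_val f) := set_valP f.
    apply: le_trans (HK (set_val f) (la (cl s)) (lb (cl s)) (la (cl t)) (lb (cl t)) ef fN _ _ _ _) _;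
      try exact: conv.
    rewrite lee_fin ler_wpM2r//.
    have E (u v : C) : nc (((1 - cl s)%:C%C * u + (cl s)%:C%C * v) - ((1 - cl t)%:C%C * u + (cl t)%:C%C * v))
       <= `|s - t| * nc (v - u).
      rewrite (_ : _ - _ = (cl s - cl t)%:C%C * (v - u)).
        by rewrite normcM nR ler_wpM2r ?normc_ge0.
      by rewrite !rmorphB rmorph1/=; ring.
    by rewrite mulrDr lerD// E.
  have [N0|N0] := leP 0%E N.
    apply: gt0_ler_poweR => //; rewrite in_itv/= leey andbT//.
    exact: le_trans NK.
  (* a negative operator norm would be the supremum of the empty set *)
  suff -> : N = -oo%E by rewrite poweRNyr ?gt_eqF ?lt_min ?ltr01// poweR_ge0.
  rewrite /N /op_norm; set A := (X in ereal_sup X).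
  have [->|/set0P[v [f fN fv]]] := eqVneq A set0; first by rewrite ereal_sup0.
  have : (0 <= N)%E.
    rewrite (@le_trans _ _ v)//; first by rewrite -fv; exact: poweR_ge0.
    by apply: ereal_sup_ubound; exists f.
  by rewrite leNgt N0.
apply: continuous_subspaceT => t U [V [oV Vt VU]]; apply: filterS VU _.
have [e e0 eV] := oV _ Vt.
pose m := Num.min 1 q; have m0 : 0 < m by rewrite lt_min ltr01.
pose LK := L * K + 1; have LK0 : 0 < LK by rewrite ltr_wpDl// mulr_ge0.
pose del := (e / 2) `^ m^-1 / LK.
have e20 : 0 < e / 2 by rewrite divr_gt0.
have del0 : 0 < del by rewrite divr_gt0// powR_gt0.
apply/nbhs_ballP; exists del => // s; rewrite /ball/= => st.
apply: eV; rewrite /comp_space_ball /=.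
apply: le_lt_trans (dist t s) _; rewrite lte_fin -/m.
apply: (@le_lt_trans _ _ (((e / 2) `^ m^-1) `^ m)).
  apply: le_powR; rewrite ?(ltW m0)// ?mulr_ge0//.
  move: st; rewrite /del ltr_pdivlMr// => /ltW; apply: le_trans.
  by rewrite -mulrA ler_wpM2l// /LK lerDl.
by rewrite -powRrM mulVf ?gt_eqF// powRr1 ?(ltW e20)//; lra.
Qed.

End composition_space.

(** * The complex exponential *)

Section complex_exponential.
Context {R : realType}.
Local Notation C := R[i].

Definition cexp (z : C) : C := (expR (Re z) * cos (Im z) +i* (expR (Re z) * sin (Im z)))%C.

Lemma normc_cexp z : nc (cexp z) = expR (Re z).
Proof.
rewrite /= !exprMn -mulrDr cos2Dsin2 mulr1 sqrtr_sqr ger0_norm//; exact: expR_ge0.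
Qed.

Lemma cexpD z w : cexp (z + w) = cexp z * cexp w.
Proof.
case: z => x y; case: w => u v; rewrite /cexp /= expRD cosD sinD.
by apply/eqP; rewrite eq_complex/=; apply/andP; split; apply/eqP; ring.
Qed.

Lemma is_derive_eps (f : R -> R) (x df : R) : is_derive x (1 : R) f df ->
  forall e : R, 0 < e -> exists2 del : R, 0 < del &
    forall h, `|h| < del -> `|f (x + h) - f x - df * h| <= e * `|h|.
Proof.
move=> [dfx <-] e e0.
have /cvgrPdist_lt := dfx => /(_ e e0); rewrite near_withinE.
move=> /nbhs_ballP[/= d d0 H]; exists d => // h hd.
have [->|h0] := eqVneq h 0; first by rewrite addr0 mulr0 subrr subr0 normr0 mulr0.
have := H h; rewrite /ball/= sub0r normrN => /(_ hd h0).
rewrite /derive -/(lim _); set l := lim _; rewrite [h%:A + x]addrC => lt.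
have E : - (f (x + h) - f x - l * h) = (l - h^-1 * (f (x + h) - f x)) * h by field.
rewrite -normrN E normrM ler_wpM2r// ltW//.
by move: lt; rewrite [h%:A]mulr1.
Qed.

Lemma has_cderiv_cexp0 : has_cderiv cexp 0 1.
Proof.
move=> e e0; pose e' := e / 8; have e'0 : 0 < e' by rewrite divr_gt0.
have [d1 d10 H1] := is_derive_eps (is_derive_expR 0) e'0.
have [d1' d1'0 H1'] := is_derive_eps (is_derive_expR 0) ltr01.
have [d2 d20 H2] := is_derive_eps (is_derive_cos 0) e'0.
have [d3 d30 H3] := is_derive_eps (is_derive_sin 0) e'0.
pose d := Num.min (Num.min d1 d1') (Num.min (Num.min d2 d3) (Num.min (1 / 2) (e' / 2))).
exists d; first by rewrite !lt_min d10 d1'0 d20 d30 !divr_gt0.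
move=> h; rewrite !lt_min => /andP[/andP[h1 h1'] /andP[/andP[h2 h3] /andP[h4 h5]]].
have xh := ler_Re_normc h; have yh := ler_Im_normc h.
case: h h1 h1' h2 h3 h4 h5 xh yh => x y.
set n := nc _ => h1 h1' h2 h3 h4 h5 xh yh; rewrite /= in xh yh.
have n0 : 0 <= n by exact: normc_ge0.
have {H1} := H1 x (le_lt_trans xh h1); have {H1'} := H1' x (le_lt_trans xh h1').
have {H2} := H2 y (le_lt_trans yh h2); have {H3} := H3 y (le_lt_trans yh h3).
rewrite !add0r expR0 cos0 sin0 oppr0 mul0r !mul1r !subr0.
set E := expR x; set c := cos y; set s := sin y => H3 H2 H1' H1.
have E0 : 0 <= E := expR_ge0 x.
have E1 : `|E - 1| <= 2 * n.
  have := ler_normD (E - 1 - x) x; rewrite subrK; lra.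
have E2 : E <= 2 by have := ler_norm (E - 1); lra.
rewrite (le_trans (normc_le_ReIm _))// /cexp/= expR0 cos0 sin0 mulr0 -/E -/c -/s.
rewrite addr0 in H3; rewrite mulr1 subr0.
have e'n : e' * `|x| <= e' * n by rewrite ler_wpM2l// ltW.
have e'n' : e' * `|y| <= e' * n by rewrite ler_wpM2l// ltW.
have p1 (u : R) : `|u| <= e' * n -> `|E * u| <= 2 * (e' * n).
  by move=> un; rewrite normrM ger0_norm//; apply: ler_pM.
have t1 : `|E * c - 1 - x| <= 3 * (e' * n).
  rewrite (_ : E * c - 1 - x = (E - 1 - x) + E * (c - 1)); last by ring.
  rewrite (le_trans (ler_normD _ _))//.
  have := p1 _ (le_trans H2 e'n'); lra.
have t2 : `|E * s - y| <= 3 * (e' * n).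
  rewrite (_ : E * s - y = E * (s - y) + (E - 1) * y); last by ring.
  rewrite (le_trans (ler_normD _ _))//.
  have : `|(E - 1) * y| <= 2 * n * n by rewrite normrM ler_pM.
  have : 2 * n * n <= e' * n by rewrite ler_wpM2r//; lra.
  have := p1 _ (le_trans H3 e'n'); lra.
have : e * n = 8 * (e' * n) by rewrite /e'; field.
have : 0 <= e' * n by rewrite mulr_ge0// ltW.
lra.
Qed.

Lemma cexp0 : cexp 0 = 1.
Proof. by rewrite /cexp /= expR0 cos0 sin0 mulr1 mulr0. Qed.

Lemma entire_cexp : entire cexp.
Proof.
apply: has_cderiv_entire => z; exists (cexp z * 1).
move=> e e0; have [d d0 H] := has_cderivMl (cexp z) has_cderiv_cexp0 e0.
exists d => // h /H; rewrite add0r cexp0 mulr1 cexpD.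
by [].
Qed.

End complex_exponential.

(** * Entire functions of linear growth *)

Section linear_growth.
Context {R : realType}.
Local Notation C := R[i].
Implicit Types (f phi : C -> C).

Lemma normc_real (s : R) : nc s%:C%C = `|s|.
Proof. by rewrite /= expr0n addr0 sqrtr_sqr. Qed.

Lemma normc_square_bound (w z : C) (r : R) :
  `|Re z - Re w| <= r -> `|Im z - Im w| <= r ->
  nc z <= nc w + 2 * r.
Proof.
move=> hx hy; rewrite -[z](subrK w) addrC (le_trans (le_normcD _ _))// lerD2l.
rewrite (le_trans (normc_le_ReIm _))//.
have -> : Re (z - w) = Re z - Re w by case: (z) => ? ?; case: (w).
have -> : Im (z - w) = Im z - Im w by case: (z) => ? ?; case: (w).
lra.
Qed.

Lemma has_cderiv_disk_bound f w (r S : R) l : entire f -> 0 < r ->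
  (forall z, nc z <= nc w + 2 * r -> nc (f z) <= S) ->
  has_cderiv f w l -> nc l <= 64 * S / r.
Proof.
case: w => x0 y0 ef r0 fS fl; apply: cderiv_bound fl => // x y hx hy.
by apply: fS; exact: normc_square_bound.
Qed.

Lemma liouville f (S : R) : entire f -> (forall z, nc (f z) <= S) ->
  forall z w, f z = f w.
Proof.
move=> ef fS z w; apply/eqP; rewrite -subr_eq0; apply/eqP/eq0_normc.
apply/eqP; rewrite eq_le normc_ge0 andbT -[leRHS](mul0r (nc (z - w))).
apply: mean_value_ineq => t _.
have [l fl] := entireP ef (w + t%:C%C * (z - w)); exists l => //.
rewrite leNgt; apply/negP => l0.
have S0 : 0 <= S := le_trans (normc_ge0 _) (fS 0).
pose r := (64 * S + 1) / nc l.
have r0 : 0 < r by rewrite divr_gt0// ltr_wpDl// mulr_ge0.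
have := has_cderiv_disk_bound ef r0 (fun z _ => fS z) fl.
by rewrite /r invf_div mulrA ler_pdivlMr ?ltr_wpDl ?mulr_ge0// mulrC ler_pM2r//; lra.
Qed.

(** Cauchy's estimate makes phi Lipschitz, so that each z -> phi (z + w) - phi z is bounded, hence
constant; then phi has the same derivative everywhere. *)
Lemma affine_of_linear_growth phi (K : R) : entire phi ->
  (forall z, nc (phi z) <= nc z + K) -> exists a b, phi = affine a b /\ nc a <= 1.
Proof.
move=> ephi grow.
have K0 : 0 <= K by have := le_trans (normc_ge0 _) (grow 0); rewrite normc0 add0r.
have lip z w : nc (phi z - phi w) <= 192 * nc (z - w).
  apply: mean_value_ineq => t _; set u := w + _.
  have [l fl] := entireP ephi u; exists l => //.
  have u0 := normc_ge0 u.
  have r0 : 0 < nc u + K + 1 by lra.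
  apply: (le_trans (has_cderiv_disk_bound ephi r0 (S := 3 * (nc u + K + 1)) _ fl)).
    by move=> z'; have := grow z'; lra.
  by rewrite ler_pdivrMr//; lra.
have shift z w : phi (z + w) - phi z = phi w - phi 0.
  have e1 : entire (fun z => phi (z + w)).
    exact: (entire_comp ephi (entireD (@entire_id R) (@entire_cst R w))).
  have e2 : entire (fun z => phi (z + w) + (-1) * phi z).
    exact: (entireD e1 (entireM (@entire_cst R (-1)) ephi)).
  have bd z' : nc (phi (z' + w) + (-1) * phi z') <= 192 * nc w.
    by rewrite mulN1r; have := lip (z' + w) z'; rewrite [z' + w]addrC addrK.
  by have := liouville e2 bd z 0; rewrite !mulN1r add0r.
have [a da] := entireP ephi 0.
have der w : has_cderiv phi w a.
  move=> e e0; have [d d0 H] := da _ e0; exists d => // h /H.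
  by rewrite add0r (shift w h).
have dpsi w : has_cderiv (fun z => phi z - a * z) w 0.
  move=> e e0; have [d d0 H] := der w _ e0; exists d => // h /H.
  rewrite mul0r subr0 mulrDr; congr (nc _ <= _); ring.
have phiE : phi = affine a (phi 0).
  apply/funext => z; rewrite /affine.
  have : nc ((phi z - a * z) - (phi 0 - a * 0)) <= 0 * nc (z - 0).
    apply: (@mean_value_ineq _ (fun z => phi z - a * z)) => t _; exists 0 => //.
    by rewrite normc0.
  rewrite mul0r mulr0 subr0 => le0.
  have /eq0_normc/eqP : nc (phi z - a * z - phi 0) = 0.
    by apply/eqP; rewrite eq_le le0 normc_ge0.
  by rewrite subr_eq0 subr_eq addrC => /eqP.
exists a, (phi 0); split => //.
rewrite leNgt; apply/negP => a1.
(* if |a| > 1, the growth bound fails at the real point t *)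
pose t := (K + nc (phi 0) + 1) / (nc a - 1).
have a0 : 0 < nc a - 1 by rewrite subr_gt0.
have p0 := normc_ge0 (phi 0).
have t0 : 0 < t by rewrite divr_gt0//; lra.
have := grow t%:C%C; rewrite {1}phiE /affine normc_real ger0_norm ?(ltW t0)// => g1.
have := le_normcD (a * t%:C%C + phi 0) (- phi 0).
rewrite addrK normcN normcM normc_real ger0_norm ?(ltW t0)// => g2.
have : t * (nc a - 1) = K + nc (phi 0) + 1 by rewrite /t divfK// gt_eqF.
lra.
Qed.

End linear_growth.

(** * Gaussian test functions *)

Section test_functions.
Context {R : realType}.
Local Notation C := R[i].
Implicit Types (f phi : C -> C) (p q : R).

Definition gauss_exp (c2 c1 c0 : C) : C -> C :=
  fun z => cexp (c2 * (z * z) + c1 * z + c0).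

Lemma entire_gauss_exp (c2 c1 c0 : C) : entire (gauss_exp c2 c1 c0).
Proof.
have e2 := entireM (@entire_cst R c2) (entireM (@entire_id R) (@entire_id R)).
have e1 := entireM (@entire_cst R c1) (@entire_id R).
exact: (entire_comp (@entire_cexp R) (entireD (entireD e2 e1) (@entire_cst R c0))).
Qed.

Lemma fock_density_cexp p (g : C -> C) (x y : R) :
  fock_density p (cexp \o g) (x, y) =
  expR (p * Re (g (x +i* y)%C) - p * (x ^+ 2 + y ^+ 2) / 2).
Proof.
rewrite /fock_density /comp /complex_of_pair normc_cexp normc_sqr /=.
by rewrite -expRM -expRD; congr expR; ring.
Qed.

Lemma fock_density_gauss_exp p (c2 c1 c0 : C) (x y : R) (z := (x +i* y)%C) :
  fock_density p (gauss_exp c2 c1 c0) (x, y) =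
  expR (p * Re (c2 * (z * z) + c1 * z + c0) - p * (x ^+ 2 + y ^+ 2) / 2).
Proof. exact: (fock_density_cexp p (fun z => c2 * (z * z) + c1 * z + c0)). Qed.

(** gauss_exp with these coefficients is the normalized reproducing kernel at w: its density is
the Gaussian of the plane centered at w. *)
Lemma kernel_norm p (w : C) : 0 < p ->
  (fock_norm p (gauss_exp 0 (w^*)%C (- (nc w ^+ 2 / 2)%:C%C))%R <= 1%:E)%E.
Proof.
case: w => u v p0; apply/(fock_norm_le _ p0 ler01); rewrite powR1 mul1r.
have p20 : 0 < p / 2 by rewrite divr_gt0.
have mv : measurable_fun setT (fun _ : R => u) by exact: measurable_cst.
have GE := @integral_gauss_plane R _ _ v (fun=> u) p20 p20 mv.
have sq : Num.sqrt (pi / (p / 2)) * Num.sqrt (pi / (p / 2)) = 2 * pi / p.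
  have pp : 0 <= pi / (p / 2) by rewrite divr_ge0 ?pi_ge0// ltW.
  rewrite -expr2 sqr_sqrtr//.
  by move: (pi : R) => P; field; rewrite gt_eqF.
rewrite sq in GE; rewrite -GE le_eqVlt; apply/orP; left; apply/eqP.
apply: eq_integral => -[x y] _; congr (_%:E); rewrite fock_density_gauss_exp.
by rewrite normc_sqr /=; congr expR; field.
Qed.

(** The kernel at w takes the value e^(|w|^2 / 2) at w, and w = phi z is chosen to compare it with
the pointwise bound for its image at z. *)
Lemma composition_linear_growth p q (M : R) phi : 0 < p -> 0 < q -> 0 <= M -> entire phi ->
  (forall f, entire f -> (fock_norm p f <= 1%:E)%E -> (fock_norm q (f \o phi) <= M%:E)%E) ->
  exists K : R, forall z, nc (phi z) <= nc z + K.
Proof.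
move=> p0 q0 M0 ephi HM; have [B B0 HB] := fock_pointwise q0 M0.
exists (2 * B + 3) => z; set w := phi z.
have ek := @entire_gauss_exp 0 (w^*)%C (- (nc w ^+ 2 / 2)%:C%C).
have := HB _ (entire_comp ek ephi) (HM _ ek (kernel_norm w p0)) z.
rewrite [(_ \o _) z]/(gauss_exp _ _ _ w) /gauss_exp normc_cexp mul0r add0r conjc_mul_self.
have -> : Re ((nc w ^+ 2)%:C%C + - (nc w ^+ 2 / 2)%:C%C) = nc w ^+ 2 / 2.
  by rewrite /=; field.
(* e^B >= B turns the constant B into an additive term of the exponent *)
have B1 : B <= expR B by have := expR_ge1Dx B; lra.
move=> /le_trans /(_ (ler_wpM2r (expR_ge0 _) B1)); rewrite -expRD ler_expR => h.
have z0 := normc_ge0 z; have w0 := normc_ge0 w.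
rewrite -(@ler_sqr _ (nc w)) ?nnegrE//; last by lra.
have : nc w ^+ 2 <= 2 * B + (nc z + 2) ^+ 2 by lra.
move=> /le_trans; apply; nra.
Qed.

(** The F^p norm of e^(al (a z)^2 / 2) with |a| = 1 is (1 - al^2)^(-1 / 2p), and
e^ka = (1 - al)^(-1 / 2p) is at least as large. *)
Lemma rotated_gauss_norm p (a : C) (ka al : R) : 0 < p -> 0 < ka -> nc a = 1 ->
  al = 1 - expR (- (2 * p * ka)) ->
  (fock_norm p (gauss_exp ((al / 2)%:C%C * (a * a)) 0 (- ka)%:C%C)%R
     <= 1%:E)%E.
Proof.
move=> p0 ka0 a1 alE; apply/(fock_norm_le _ p0 ler01); rewrite powR1 mul1r.
have e0 : 0 < expR (- (2 * p * ka)) by exact: expR_gt0.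
have e1 : expR (- (2 * p * ka)) < 1 by rewrite expR_lt1 oppr_lt0 !mulr_gt0.
have al0 : 0 < al by rewrite alE; lra.
have al1 : al < 1 by rewrite alE; lra.
have [c [s [aE cs]]] : exists c s : R, a * a = (c +i* s)%C /\ c ^+ 2 + s ^+ 2 = 1.
  have := normcM a a; rewrite a1 mulr1; case: (a * a) => c s h; exists c, s; split => //.
  by rewrite -[LHS](normc_sqr (c +i* s)%C) h expr1n.
have c1 : c <= 1 by have := sqr_ge0 s; nra.
have alc : 0 < 1 - al * c.
  have [c0|c0] := leP c 0; [nra|nra].
pose A := p / 2 * (1 - al * c); pose B := p / 2 * ((1 - al ^+ 2) / (1 - al * c)).
have al2 : 0 < 1 - al ^+ 2 by nra.
have A0 : 0 < A by rewrite mulr_gt0// divr_gt0.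
have B0 : 0 < B by rewrite mulr_gt0 ?divr_gt0.
pose m (y : R) := - (al * s / (1 - al * c)) * y.
have mm : measurable_fun setT m by exact: measurable_funM.
have GE := @integral_gauss_plane R A B 0 m A0 B0 mm.
have dE (xy : R * R) : ((fock_density p (gauss_exp ((al / 2)%:C%C * (a * a)) 0 (- ka)%:C%C)%R xy)%:E
    = (expR (- (p * ka)))%:E * (expR (- (A * (xy.1 - m xy.2) ^+ 2 + B * (xy.2 - 0) ^+ 2)))%:E)%E.
  case: xy => x y; rewrite fock_density_gauss_exp aE -EFinM -expRD /=; congr (expR _)%:E.
  have s2 : s ^+ 2 = 1 - c ^+ 2 by rewrite -cs addrC addKr.
  have -> : A * (x - m y) ^+ 2 = p / 2 * ((1 - al * c) * x ^+ 2 + 2 * al * s * x * y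
     + al ^+ 2 * s ^+ 2 * y ^+ 2 / (1 - al * c)).
    by rewrite /A /m; field; rewrite gt_eqF.
  rewrite s2 /B; field; rewrite gt_eqF//.
under eq_integral do rewrite dE.
rewrite ge0_integralZl_EFin//; first last.
- by apply/measurable_EFinP; exact: gauss_plane_measurable.
rewrite GE -EFinM lee_fin -sqrtrM; last by rewrite divr_ge0 ?pi_ge0// ltW.
have P0 : 0 < pi :> R by exact: pi_gt0.
have pp0 : 0 <= 2 * pi / p by rewrite divr_ge0 ?mulr_ge0 ?(ltW P0)// ltW.
rewrite expRN ler_pdivrMl ?expR_gt0//.
have r0 : 0 <= expR (p * ka) * (2 * pi / p) by rewrite mulr_ge0 ?expR_ge0.
rewrite -[leRHS]ger0_norm// -sqrtr_sqr ler_wsqrtr//.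
have -> : pi / A * (pi / B) = (2 * pi / p) ^+ 2 * (1 - al ^+ 2)^-1.
  rewrite /A /B; move: P0; move: (pi : R) => P P0; field.
  by rewrite !gt_eqF.
rewrite [leRHS]exprMn [leRHS]mulrC ler_wpM2l ?sqr_ge0// -expRM_natl.
have -> : 2%:R * (p * ka) = - (- (2 * p * ka)) by ring.
rewrite expRN lef_pV2 ?posrE//.
have -> : expR (- (2 * p * ka)) = 1 - al by rewrite alE; ring.
by nra.
Qed.

End test_functions.

(** * Bounded composition operators *)

Section necessity.
Context {R : realType}.
Local Notation C := R[i].
Implicit Types (f phi : C -> C) (p q : R).

(** Composition with a z + b undoes the rotation by the conjugate of a and leaves
e^(al (z + b1 + i b2)^2 / 2 - ka). The translation can only increase the integral in x, and costs
at most a factor e^(- q |b|^2 / 2) in y; the integral in x is of order (1 - al)^(-1/2). *)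
Lemma rotated_gauss_comp_norm q (a b : C) (ka al M : R) : 0 < q -> nc a = 1 ->
  0 <= al -> al < 1 -> 0 <= M ->
  (fock_norm q (gauss_exp ((al / 2)%:C%C * ((a^*)%C * (a^*)%C)) 0 (- ka)%:C%C \o affine a b)%R
     <= M%:E)%E ->
  expR (- (q * ka)) <= 2 * Num.sqrt (1 - al) * (M `^ q * expR (q / 2 * nc b ^+ 2)).
Proof.
move=> q0 a1 al0 al1 M0; set F := (_ \o _).
move=> /(fock_norm_le _ q0 M0).
have [b1 [b2 [bE bn]]] : exists b1 b2 : R, (a^*)%C * b = (b1 +i* b2)%C /\
    b1 ^+ 2 + b2 ^+ 2 = nc b ^+ 2.
  have aa : nc (a^*)%C = 1 by rewrite -a1; case: (a) => u v /=; rewrite sqrrN.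
  have := normcM (a^*)%C b; rewrite aa mul1r; case: (_ * b) => b1 b2 h.
  by exists b1, b2; split => //; rewrite -h normc_sqr.
pose A := q / 2 * (1 - al); pose B := q / 2 * (1 + al).
have A0 : 0 < A by rewrite mulr_gt0 ?divr_gt0// subr_gt0.
have B0 : 0 < B by rewrite mulr_gt0 ?divr_gt0// ltr_wpDr.
have m_ : measurable_fun setT (fun _ : R => al * b1 / (1 - al)) by exact: measurable_cst.
have GE := @integral_gauss_plane R A B (- (al * b2 / (1 + al))) _ A0 B0 m_.
pose k := expR (- (q * ka)) * expR (- (q / 2 * nc b ^+ 2)).
have k0 : 0 <= k by rewrite mulr_ge0 ?expR_ge0.
have eF : entire F := entire_comp (@entire_gauss_exp R _ _ _) (@entire_affine R a b).
move=> le1.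
have le2 : (\int[(mu \x mu)%E]_xy (k%:E * (expR (- (A * (xy.1 - al * b1 / (1 - al)) ^+ 2 +
      B * (xy.2 - - (al * b2 / (1 + al))) ^+ 2)))%:E) <=
    \int[(mu \x mu)%E]_xy (fock_density q F xy)%:E)%E.
  apply: ge0_le_integral => //.
  - by move=> xy _; rewrite -EFinM lee_fin mulr_ge0// expR_ge0.
  - apply/measurable_EFinP; apply: measurable_funM => //.
    exact: (@gauss_plane_measurable _ _ _ _ (fun=> al * b1 / (1 - al))).
  - by apply/measurable_EFinP; exact: fock_density_measurable.
  case=> x y _; rewrite -EFinM lee_fin /k /F.
  rewrite (fock_density_cexp q (fun z => (al / 2)%:C%C * ((a^*)%C * (a^*)%C) * (affine a b z * affine a b z)
     + 0 * affine a b z + (- ka)%:C%C)).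
  set z := (x +i* y)%C; rewrite -!expRD ler_expR.
  have cc : (a^*)%C * affine a b z = ((x + b1) +i* (y + b2))%C.
    rewrite /affine mulrDr mulrA conjc_mul_self a1 expr1n bE mul1r.
    by apply/eqP; rewrite eq_complex/= !eqxx.
  have -> : (al / 2)%:C%C * ((a^*)%C * (a^*)%C) * (affine a b z * affine a b z)
     + 0 * affine a b z + (- ka)%:C%C =
     (al / 2)%:C%C * (((a^*)%C * affine a b z) * ((a^*)%C * affine a b z)) + (- ka)%:C%C by ring.
  rewrite cc /= -bn.
  have q2 : 0 <= q / 2 by rewrite divr_ge0// ltW.
  have hb1 : A * (x - al * b1 / (1 - al)) ^+ 2 >= q / 2 * (x ^+ 2 - al * (x + b1) ^+ 2).
    rewrite -subr_ge0 (_ : _ - _ = q / 2 * (al * b1 ^+ 2 / (1 - al))).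
      apply: mulr_ge0 => //; apply: divr_ge0; last by lra.
      by apply: mulr_ge0 => //; exact: sqr_ge0.
    by rewrite /A; field; rewrite gt_eqF// subr_gt0.
  have hb2 : B * (y - - (al * b2 / (1 + al))) ^+ 2 + q / 2 * b2 ^+ 2 >=
      q / 2 * (y ^+ 2 + al * (y + b2) ^+ 2).
    rewrite -subr_ge0 (_ : _ - _ = q / 2 * (b2 ^+ 2 / (1 + al))).
      apply: mulr_ge0 => //; apply: divr_ge0; last by lra.
      exact: sqr_ge0.
    by rewrite /B; field; rewrite gt_eqF// ltr_wpDr.
  have b1q : 0 <= q / 2 * b1 ^+ 2 by rewrite mulr_ge0 ?sqr_ge0.
  lra.
move: (le_trans le2 le1); rewrite ge0_integralZl_EFin//; last first.
  apply/measurable_EFinP.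
  exact: (@gauss_plane_measurable _ _ _ _ (fun=> al * b1 / (1 - al))).
rewrite GE -EFinM lee_fin -sqrtrM; last by rewrite divr_ge0 ?pi_ge0// ltW.
have P0 : 0 < pi :> R by exact: pi_gt0.
have s0 : 0 < 1 - al by rewrite subr_gt0.
have sq0 : 0 < Num.sqrt (1 - al) by rewrite sqrtr_gt0.
have lb : 2 * pi / q * (2 * Num.sqrt (1 - al))^-1 <= Num.sqrt (pi / A * (pi / B)).
  have r0 : 0 <= 2 * pi / q * (2 * Num.sqrt (1 - al))^-1.
    by rewrite mulr_ge0 ?invr_ge0 ?divr_ge0 ?mulr_ge0 ?(ltW P0) ?(ltW q0) ?(ltW sq0).
  rewrite -[leLHS]ger0_norm// -sqrtr_sqr ler_wsqrtr//.
  have -> : (2 * pi / q * (2 * Num.sqrt (1 - al))^-1) ^+ 2 = (2 * pi / q) ^+ 2 * (4 * (1 - al))^-1.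
    rewrite -[in RHS](sqr_sqrtr (ltW s0)).
    by move: (pi : R) => P; field; rewrite !gt_eqF.
  have -> : pi / A * (pi / B) = (2 * pi / q) ^+ 2 * ((1 - al) * (1 + al))^-1.
    rewrite /A /B; move: P0; move: (pi : R) => P P0; field.
    by rewrite !gt_eqF// ?subr_gt0// ltr_wpDr.
  rewrite ler_wpM2l ?sqr_ge0// lef_pV2 ?posrE ?mulr_gt0 ?exprn_gt0//; last by rewrite ltr_wpDr.
  by nra.
have pq0 : 0 < 2 * pi / q by rewrite divr_gt0// mulr_gt0.
move=> /(le_trans (ler_wpM2l k0 lb)).
rewrite mulrCA [leRHS]mulrC ler_pM2l// ler_pdivrMr ?mulr_gt0// /k [expR (- (q / 2 * _))]expRN.
rewrite ler_pdivrMr ?expR_gt0// => /le_trans; apply.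
by rewrite le_eqVlt; apply/orP; left; apply/eqP; ring.
Qed.

(** With al tied to ka as in [rotated_gauss_norm], 1 - al = e^(- 2 p ka), the bound of
[rotated_gauss_comp_norm] reads e^((p - q) ka) <= D, false for large ka. *)
Lemma unimodular_unbounded p q (M : R) (a b : C) : 0 < q -> q < p -> 0 <= M -> nc a = 1 ->
  ~ (forall f, entire f -> (fock_norm p f <= 1%:E)%E ->
       (fock_norm q (f \o affine a b) <= M%:E)%E).
Proof.
move=> q0 qp M0 a1 HM; have p0 : 0 < p := lt_trans q0 qp.
pose D := 2 * (M `^ q * expR (q / 2 * nc b ^+ 2)).
have D0 : 0 <= D by rewrite mulr_ge0// mulr_ge0 ?powR_ge0 ?expR_ge0.
pose ka := (D + 1) / (p - q).
have pq0 : 0 < p - q by rewrite subr_gt0.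
have ka0 : 0 < ka by rewrite divr_gt0// ltr_wpDl.
pose al := 1 - expR (- (2 * p * ka)).
have aa : nc (a^*)%C = 1 by rewrite -a1; case: (a) => u v /=; rewrite sqrrN.
have e0 : 0 < expR (- (2 * p * ka)) by exact: expR_gt0.
have e1 : expR (- (2 * p * ka)) < 1 by rewrite expR_lt1 oppr_lt0 (mulr_gt0 _ ka0)// mulr_gt0.
have al0 : 0 <= al by rewrite /al; lra.
have al1 : al < 1 by rewrite /al; lra.
have ef := @entire_gauss_exp R ((al / 2)%:C%C * ((a^*)%C * (a^*)%C)) 0 (- ka)%:C%C.
have := rotated_gauss_comp_norm q0 a1 al0 al1 M0 (HM _ ef (rotated_gauss_norm p0 ka0 aa erefl)).
have -> : Num.sqrt (1 - al) = expR (- (p * ka)).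
  rewrite (_ : 1 - al = expR (- (p * ka)) ^+ 2); first by rewrite sqrtr_sqr ger0_norm// expR_ge0.
  by rewrite -expRM_natl /al opprB addrC subrK; congr expR; ring.
rewrite mulrAC -/D [expR (- (p * ka))]expRN ler_pdivlMr ?expR_gt0// -expRD.
have -> : - (q * ka) + p * ka = D + 1 by rewrite /ka; field; rewrite gt_eqF.
by have := expR_ge1Dx (D + 1); lra.
Qed.

Lemma bounded_composition_affine p q (T : fock p -> C -> C) : 0 < q -> q < p ->
  @bounded_composition_ops R p q T ->
  exists a b, nc a < 1 /\ T = @composition_op R p (affine a b).
Proof.
move=> q0 qp [[phi ephi TE] [Tmap Tnorm]]; have p0 : 0 < p := lt_trans q0 qp.
have [M M0 HM] : exists2 M : R, 0 <= M & forall f, entire f ->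
    (fock_norm p f <= 1%:E)%E -> (fock_norm q (f \o phi) <= M%:E)%E.
  pose M := Num.max 0 (fine (op_norm q T)).
  exists M; first by rewrite le_max lexx.
  move=> f ef fN.
  have fm : fock p f by split => //; exact: le_lt_trans fN (ltry _).
  have le : (fock_norm q (f \o phi) <= op_norm q T)%E.
    apply: ereal_sup_ubound; exists (SigSub (mem_set fm) : fock p); first exact: fN.
    by rewrite TE.
  have N0 : (0 <= fock_norm q (f \o phi))%E by exact: poweR_ge0.
  have fin : op_norm q T \is a fin_num.
    by rewrite ge0_fin_numE//; exact: le_trans le.
  by rewrite (le_trans le)// -(fineK fin) lee_fin le_max lexx orbT.
have [K HK] := composition_linear_growth p0 q0 M0 ephi HM.
have [a [b [phiE a1]]] := affine_of_linear_growth ephi HK.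
exists a, b; split; last by rewrite TE phiE.
rewrite lt_neqAle a1 andbT; apply/eqP => aE.
by move: HM; rewrite phiE; exact: unimodular_unbounded.
Qed.

End necessity.

Theorem corollary4p5 (R : realType) (p q : R) (hq : 0 < q) (hqp : q < p) :
  path_connected R (comp_space R p q).
Proof.
move=> S T; have hp : 0 < p := lt_trans hq hqp.
have [a [b [a1 SE]]] := bounded_composition_affine hq hqp (set_valP S).
have [a' [b' [a1' TE]]] := bounded_composition_affine hq hqp (set_valP T).
exact: (affine_path_connected hp hq a1 a1' SE TE).
Qed.
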